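(* Let $P\subset\mathbb{R}^n$ be a $d$-dimensional rational polytope (not necessarily full-dimensional) with vertex set $V(P)$, and let $M\ge 0$ be an integer. For any triangulation $\mathcal{D}_s$ of the cone $C_s(P)$ of feasible directions at each of the vertices $s$ of $P$, we have $$L^M(P)(\ell)=\sum_{s\in V(P)}\ \sum_{C\in\mathcal{D}_s}L^M(s+C)(\ell).$$
   Context: Linear forms $\ell$ on $\mathbb{R}^n$ are identified with vectors via the standard pairing $\langle\cdot,\cdot\rangle$. For a rational polyhedron $P$, $dm$ is the integral Lebesgue measure on the affine hull of $P$: on a rational linear subspace $L$ it is Lebesgue measure normalized so that a fundamental domain of the lattice $L\cap\mathbb{Z}^n$ has volume $1$, and it is carried to affine subspaces parallel to $L$ by translation (in the full-dimensional case it is ordinary Lebesgue measure). For a vertex $s$ of $P$, the cone of feasible directions is $C_s(P)=\{\,y: s+\epsilon y\in P\text{ for some }\epsilon>0\,\}$. A triangulation $\mathcal{D}_s$ of $C_s(P)$ is a finite collection of $d$-dimensional simplicial cones, each generated by $d$ linearly independent integral vectors, whose union is $C_s(P)$ and any two of which intersect in a common face. For a polyhedron $Q$, $L^M(Q)$ is the meromorphic extension of the function defined by $L^M(Q)(\ell)=\int_Q\langle\ell,x\rangle^M\,dm$ for those $\ell$ such that the integral exists. For a simplicial cone $C=\sum_{i=1}^d\mathbb{R}_{\ge0}u_i$ with linearly independent integral generators $u_i$ and a point $s$, the value of the integral of $\langle\ell,x\rangle^M$ over $s+C$ is recovered from the identity of meromorphic functions $$\int_{s+C}e^{\langle t\ell,x\rangle}\,dm=\operatorname{vol}(\Pi_C)\,e^{\langle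 t\ell,s\rangle}\prod_{i=1}^d\frac{1}{\langle-t\ell,u_i\rangle},\qquad \Pi_C=\sum_{i=1}^d[0,1)\,u_i,$$ where $\operatorname{vol}(\Pi_C)$ is the volume of $\Pi_C$, as $M!$ times the coefficient of $t^M$ in the Laurent series at $t=0$. When $\ell$ is regular for $C$, i.e. $\langle\ell,u_i\rangle\ne0$ for all $i$, this gives $$L^M(s+C)(\ell)=\frac{M!}{(M+d)!}\operatorname{vol}(\Pi_C)\frac{\langle\ell,s\rangle^{M+d}}{\prod_{i=1}^d\langle-\ell,u_i\rangle}.$$ When $\ell$ is not regular, one perturbs it to $\ell+\hat\epsilon$ with $\hat\epsilon=\epsilon a$, $a\in\mathbb{R}^n$, such that $\langle-\ell-\hat\epsilon,u_i\rangle\ne0$ for all $u_i$, and $$L^M(s+C)(\ell)=\frac{M!}{(M+d)!}\operatorname{vol}(\Pi_C)\operatorname{Res}_{\epsilon=0}\frac{\langle\ell+\hat\epsilon,s\rangle^{M+d}}{\epsilon\prod_{i=1}^d\langle-\ell-\hat\epsilon,u_i\rangle},$$ where $\operatorname{Res}_{\epsilon=0}$ is the coefficient of $\epsilon^{-1}$ in the Laurent expansion at $\epsilon=0$. The same $a$ is used for all the cones in the sum, chosen so that no denominator vanishes identically on any of them. *)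

(* Defs.v *)
From HB Require Import structures.
From mathcomp Require Import all_boot all_order all_algebra.
From mathcomp Require Import all_classical all_reals all_analysis.
Set Implicit Arguments.
Unset Strict Implicit.
Unset Printing Implicit Defensive.
Import Order.TTheory GRing.Theory Num.Theory.
Import numFieldNormedType.Exports.
Local Open Scope classical_set_scope.
Local Open Scope ring_scope.

Section LebesgueTuple.
Variable R : realType.
Let T := measurableTypeR R.

Definition tcons d (p : T * d.-tuple T) : d.+1.-tuple T := [tuple of p.1 :: p.2].
Definition tuncons d (t : d.+1.-tuple T) : T * d.-tuple T :=
  (thead t, [tuple of behead t]).

Lemma tconsK d : cancel (@tcons d) (@tuncons d).
Proof. by case=> x t; rewrite /tuncons /tcons theadE; congr pair; exact/val_inj. Qed.

Lemma tunconsK d : cancel (@tuncons d) (@tcons d).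
Proof. by move=> t; rewrite /tcons/= [RHS]tuple_eta; exact/val_inj. Qed.

Lemma measurable_tcons d : measurable_fun [set: T * d.-tuple T] (@tcons d).
Proof. exact: measurable_cons. Qed.

Lemma measurable_tuncons d : measurable_fun [set: d.+1.-tuple T] (@tuncons d).
Proof.
apply/measurable_fun_pair; first exact: measurable_tnth.
exact: measurable_behead.
Qed.


Section Step.
Local Open Scope ereal_scope.
Variables (d : nat) (mu : {sigma_finite_measure set (d.-tuple T) -> \bar R}).

Definition lebesgue_tuple_step : set (d.+1.-tuple T) -> \bar R :=
  pushforward ((@lebesgue_measure R) \x mu) (@tcons d).

Let mtcons (A : set (d.+1.-tuple T)) : measurable A -> measurable (@tcons d @^-1` A).
Proof. by move=> mA; rewrite -[X in measurable X]setTI; exact: measurable_tcons. Qed.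

Let step0 : lebesgue_tuple_step set0 = 0.
Proof. by rewrite /lebesgue_tuple_step /pushforward preimage_set0 measure0. Qed.

Let step_ge0 A : 0 <= lebesgue_tuple_step A.
Proof. by rewrite /lebesgue_tuple_step /pushforward measure_ge0. Qed.

Let step_sigma_additive : semi_sigma_additive lebesgue_tuple_step.
Proof.
move=> F mF tF mUF; rewrite /lebesgue_tuple_step /pushforward preimage_bigcup.
apply: measure_semi_sigma_additive.
- by move=> n; exact: mtcons.
- apply/trivIsetP => /= i j _ _ ij; rewrite -preimage_setI.
  by move/trivIsetP : tF => /(_ _ _ _ _ ij) ->//; rewrite preimage_set0.
- by rewrite -preimage_bigcup; exact: mtcons.
Qed.

HB.instance Definition _ := isMeasure.Build _ _ _ lebesgue_tuple_step
  step0 step_ge0 step_sigma_additive.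

Let step_sigma_finite : sigma_finite setT lebesgue_tuple_step.
Proof.
have /sigma_finiteP[F [TF ndF Foo]] := sigma_finiteT (@lebesgue_measure R).
have /sigma_finiteP[G [TG ndG Goo]] := sigma_finiteT mu.
exists (fun k => @tuncons d @^-1` (F k `*` G k)).
  apply/esym; rewrite -subTset => t _.
  have [i _ Fi] : (\bigcup_i F i) (tuncons t).1 by rewrite -TF.
  have [j _ Gj] : (\bigcup_i G i) (tuncons t).2 by rewrite -TG.
  exists (maxn i j) => //; split.
    by move: Fi; exact/subsetPset/ndF/leq_maxl.
  by move: Gj; exact/subsetPset/ndG/leq_maxr.
move=> k; have [mF Fk] := Foo k; have [mG Gk] := Goo k; split.
  rewrite -[X in measurable X]setTI; apply: measurable_tuncons => //.
  exact: measurableX.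
rewrite /lebesgue_tuple_step /pushforward -comp_preimage.
rewrite (_ : _ \o _ = id) ?preimage_id; last by apply/funext => x /=; rewrite tconsK.
by rewrite product_measure1E// lte_mul_pinfty// ge0_fin_numE.
Qed.

HB.instance Definition _ := Measure_isSigmaFinite.Build _ _ _ lebesgue_tuple_step
  step_sigma_finite.

End Step.

(* Lebesgue measure on R^d, realised on d-tuples; it is the point mass for
   d = 0. *)
Fixpoint lebesgue_tuple d : {sigma_finite_measure set (d.-tuple T) -> \bar R} :=
  if d is d'.+1 then lebesgue_tuple_step (lebesgue_tuple d')
  else \d_([tuple] : 0.-tuple T).

End LebesgueTuple.

Section Polyhedra.
Variables (R : realType) (n : nat).
Local Notation V := 'rV[R]_n.
Implicit Types (l s x : V) (P Q L K F : set V) (d : nat).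

Definition dotp l x : R := \sum_i l 0 i * x 0 i.

Definition toR m p (A : 'M[int]_(m, p)) : 'M[R]_(m, p) := map_mx intr A.

Definition rational_polyhedron P := exists m (A : 'M[rat]_(m, n)) (b : 'cV[rat]_m),
  P = [set x | forall i, dotp (map_mx ratr (row i A)) x <= ratr (b i 0)].

Definition rational_polytope P := rational_polyhedron P /\ bounded_set P.

Definition is_face F Q := exists (c : V) (b : R),
  (forall x, Q x -> dotp c x <= b) /\ F = [set x | Q x /\ dotp c x = b].

Definition vertices P : set V := [set s | is_face [set s] P].

Definition affine_hull Q : set V := [set x | exists k (p : 'I_k -> V) (c : 'I_k -> R),
  [/\ forall i, Q (p i), \sum_i c i = 1 & x = \sum_i c i *: p i]].

(* the linear subspace parallel to the affine hull *)
Definition direction Q : set V :=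
  [set v | exists x y, [/\ affine_hull Q x, affine_hull Q y & v = x - y]].

(* Never satisfied by the empty set, whose [direction] is empty. *)
Definition has_dim Q d := exists2 W : 'M[R]_(d, n),
  row_free W & direction Q = [set v : V | (v <= W)%MS].

(* The rows of B form a basis of the lattice of integral points of L. *)
Definition is_lattice_basis d L (B : 'M[int]_(d, n)) :=
  row_free (toR B) /\
  forall z : 'rV[int]_n, L (toR z) <-> exists w : 'rV[int]_d, z = w *m B.

Definition lattice_basis d L : 'M[int]_(d, n) := xget 0 (@is_lattice_basis d L).

(* Affine parametrisation of the affine hull of the d-dimensional rational
   polyhedral set Q by R^d, sending Z^d onto a translate of the lattice of
   integral points of the direction of Q. The integral Lebesgue measure dm of
   the affine hull is the image under [chart d Q] of Lebesgue measure on R^d; it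
   depends neither on the lattice basis nor on the base point. *)
Definition chart d Q (y : d.-tuple (measurableTypeR R)) : V :=
  xget 0 Q + (\row_i tnth y i) *m toR (lattice_basis d (direction Q)).

Definition vol d Q : R := fine (lebesgue_tuple R d (@chart d Q @^-1` Q)).

(* For a polytope the integral defining L^M exists for every l. *)
Definition LM d (M : nat) Q l : R :=
  \int[lebesgue_tuple R d]_(y in @chart d Q @^-1` Q) dotp l (chart Q y) ^+ M.

Definition feasible_cone P s : set V :=
  [set y | exists2 e : R, 0 < e & P (s + e *: y)].

(* The integral generators of a simplicial cone are the rows of a matrix u. *)
Definition cone d (u : 'M[int]_(d, n)) : set V :=
  [set x | exists2 t : 'rV[R]_d, (forall i, 0 <= t 0 i) & x = t *m toR u].

Definition parallelepiped d (u : 'M[int]_(d, n)) : set V :=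
  [set x | exists2 t : 'rV[R]_d, (forall i, 0 <= t 0 i < 1) & x = t *m toR u].

(* The first two conditions make D list each cone of the collection once, with
   one choice of generators. *)
Definition is_triangulation d K (D : seq 'M[int]_(d, n)) :=
  [/\ uniq D,
      {in D &, injective (@cone d)},
      forall u, u \in D -> row_free (toR u),
      K = \bigcup_(u in [set` D]) cone u &
      forall u v, u \in D -> v \in D ->
        is_face (cone u `&` cone v) (cone u) /\
        is_face (cone u `&` cone v) (cone v)].

End Polyhedra.

Section ConeIntegral.
Variables (R : realType).

(* c is the family of coefficients of the Laurent expansion of f at 0. *)
Definition is_laurent (f : R -> R) (c : int -> R) := exists N : nat,
  (forall k : int, k < - N%:Z -> c k = 0) /\
  \forall t \near 0^', series (fun j : nat =>
    c (j%:Z - N%:Z) * t ^ (j%:Z - N%:Z)) @ \oo --> f t.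

(* Laurent coefficients are unique when they exist. *)
Definition laurent_coef (f : R -> R) (k : int) : R :=
  xget (fun=> 0) (is_laurent f) k.

Definition residue (f : R -> R) : R := laurent_coef f (- 1).

Variables (n d : nat).
Implicit Types (l s a : 'rV[R]_n) (u : 'M[int]_(d, n)).

Definition gen u (i : 'I_d) : 'rV[R]_n := row i (toR R u).

Definition regular u l : bool := [forall i, dotp l (gen u i) != 0].

(* The meromorphic extension in l of the integral of exp <l, x> dm over
   s + cone u, which converges when <l, u_i> < 0 for all i. *)
Definition exp_cone s u l : R :=
  vol d (@parallelepiped R n d u) * expR (dotp l s) * \prod_i (dotp (- l) (gen u i))^-1.

(* The value at l of L^M (s + cone u), computed by perturbation in the
   direction a when l is not regular. *)
Definition LM_cone (M : nat) s u a l : R :=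
  if regular u l then
    M`!%:R * laurent_coef (fun t => exp_cone s u (t *: l)) M%:Z
  else
    M`!%:R / (M + d)`!%:R * vol d (@parallelepiped R n d u) *
    residue (fun e => dotp (l + e *: a) s ^+ (M + d) /
                      (e * \prod_i dotp (- l - e *: a) (gen u i))).

End ConeIntegral.

(* Main.v *)
Require Import Defs.
From mathcomp Require Import all_boot all_order all_algebra.
From mathcomp Require Import all_classical all_reals all_analysis.
From mathcomp Require Import measurable_realfun zify ring lra.
Set Implicit Arguments.
Unset Strict Implicit.
Unset Printing Implicit Defensive.
Import Order.TTheory GRing.Theory Num.Theory.
Import numFieldNormedType.Exports.
Local Open Scope classical_set_scope.
Local Open Scope ring_scope.

(** The formula holds because, for a form [l] that vanishes on no generator, the
    indicator of [P] is almost everywhere a signed sum of indicators of cones on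
    which [l] decreases. Write a point as [x = s + sum_i t_i u_i] in the frame of a
    cone [C] of the triangulation at the vertex [s]. The indicator of [s + C] is the
    product of the indicators of [t_i >= 0]; replacing this factor by that of
    [t_i >= 0] minus [1], that is by minus the indicator of [t_i < 0], whenever
    [<l, u_i> > 0], gives the flipped cone of Lawrence and Varchenko, and
    [flip_identity] states that [P] is the sum of all flipped cones.

    The identity is proved without any theory of valuations. Let [f] be the
    difference of the two sides. Near every point [p] it is a finite sum of functions
    each of which is constant along a direction on which [l] does not vanish
    ([tame]): near a point other than its apex, a flipped cone is constant along a
    generator; near a point that is not a vertex, [P] is constant along a line of
    its minimal face, and [l] is first taken generic enough not to vanish on it; near
    a vertex, [P] is the union of the cones of the triangulation, and a cone differs
    from its flipped version by terms that ignore one coordinate. A tame function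
    that vanishes above [p] vanishes near [p] ([local_vanishing]), so [f] cannot have
    a highest point of support; it would have one if it were not zero, since only a
    bounded part of each flipped cone lies above a given level of [l]
    ([tame_vanishing]). To have an identity at every point, boundaries are
    distributed by an infinitesimal displacement in a generic direction [w].

    Integrating the identity against the truncated power [(<l, x> + h)_+^M] only
    involves convergent integrals. A linear change of variables
    ([ge0_integral_row_linear]) brings a flipped cone to an orthant, where
    integrating out one coordinate raises the exponent by one
    ([integral_tpow_orthant]); the signs of the flips turn the product of the
    [|<l, u_i>|] into that of the [<- l, u_i>]. For [h] large the truncation is void
    on [P], and both sides are polynomials in [h], so the formula holds for all [h]
    ([brion_generic]).

    Along a line [l + e a] the left-hand side is a polynomial in [e] and every cone
    term is a rational function of [e] with a Laurent expansion at [0]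
    ([laurent_rational]). By uniqueness of Laurent coefficients an identity valid for
    small [e <> 0] passes to constant terms ([brion_limit]). This removes the
    genericity of [l] ([brion_regular]), and then its regularity ([brion_laurent]).
    The constant term is the value at [l] of a cone for which [l] is regular, and
    the residue in the definition of [LM_cone] otherwise ([cone_quot_laurent]).

    Finally a lattice basis of the direction of [P], which exists by the Smith normal
    form, identifies the affine hull with [R^d] and the integral measure with
    Lebesgue measure. *)

(** * Lebesgue measure on R^d under translations and linear maps *)
Section LebesgueLine.
Variable R : realType.
Local Notation T := (measurableTypeR R).
Local Notation leb := (@lebesgue_measure R).

Lemma measurable_shift (v : R) : measurable_fun [set: T] (fun x : T => (x + v : T)).
Proof. exact: measurable_funD. Qed.

Lemma lebesgue_measure_shift (v : R) (A : set R) : measurable A ->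
  pushforward leb ((fun x => x + v) : _ -> measurableTypeR R) A = leb A.
Proof.
move=> mA; apply/esym/lebesgue_measure_unique => //=; first exact: measurable_shift.
move=> _ _ [[a b]] _ <-; rewrite /pushforward.
rewrite (_ : _ @^-1` _ = `]a - v, b - v]%classic).
  rewrite !lebesgue_measure_itv/= !lte_fin ltrD2r.
  by rewrite -!EFinB; case: ifP => // _; congr (_%:E); ring.
by apply/seteqP; split => x /=; rewrite !in_itv/= ltrBlDr lerBrDr.
Qed.

Lemma ge0_integral_shift (v : R) (f : T -> \bar R) :
  measurable_fun setT f -> (forall x, 0 <= f x)%E ->
  (\int[leb]_x f (x + v)%R = \int[leb]_x f x)%E.
Proof.
move=> mf f0; rewrite -[RHS](_ : \int[pushforward leb ((fun x => x + v)%R : R -> T)]_x f x = _)%E.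
  by rewrite ge0_integral_pushforward//; exact: measurable_shift.
apply: eq_measure_integral; first exact: measurable_shift.
by move=> mphi A mA _; exact: lebesgue_measure_shift.
Qed.

End LebesgueLine.

Section LebesgueTuple.
Variable R : realType.
Local Notation T := (measurableTypeR R).
Local Notation leb := (@lebesgue_measure R).
Local Notation mu d := (lebesgue_tuple R d).
Local Open Scope ereal_scope.

Lemma ge0_integral_tuple0 (f : 0.-tuple T -> \bar R) :
  measurable_fun setT f -> (forall x, 0 <= f x) ->
  \int[mu 0]_t f t = f [tuple].
Proof. by move=> mf f0; rewrite integral_dirac// diracT mul1e. Qed.

(** Tonelli's theorem for the recursive definition of the measure. *)
Lemma ge0_integral_tupleS d (f : d.+1.-tuple T -> \bar R) :
  measurable_fun setT f -> (forall x, 0 <= f x) ->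
  \int[mu d.+1]_t f t = \int[leb]_x \int[mu d]_t f (tcons (x, t)).
Proof.
move=> mf f0.
transitivity (\int[pushforward (leb \x mu d) (@tcons R d)]_t f t) => //.
rewrite ge0_integral_pushforward//; last exact: measurable_tcons.
rewrite (fubini_tonelli1 (f \o @tcons R d))// => [|x]; last exact: f0.
by apply: measurableT_comp => //; exact: measurable_tcons.
Qed.

Lemma measurable_funSum dd (X : measurableType dd) I (r : seq I) (h : I -> X -> R) :
  (forall i, measurable_fun setT (h i)) ->
  measurable_fun setT (fun x => \sum_(i <- r) h i x)%R.
Proof.
move=> mh; elim: r => [|i r IH].
  by under eq_fun do rewrite big_nil; exact: measurable_cst.
by under eq_fun do rewrite big_cons; exact: measurable_funD.
Qed.

Lemma measurable_funProd dd (X : measurableType dd) I (r : seq I) (h : I -> X -> R) :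
  (forall i, measurable_fun setT (h i)) ->
  measurable_fun setT (fun x => \prod_(i <- r) h i x)%R.
Proof.
move=> mh; elim: r => [|i r IH].
  by under eq_fun do rewrite big_nil; exact: measurable_cst.
by under eq_fun do rewrite big_cons; exact: measurable_funM.
Qed.

(** Measures live on tuples and linear algebra on row vectors; [rowt] and [trow]
    pass from one to the other. *)
Definition rowt d (t : d.-tuple T) : 'rV[R]_d := \row_i tnth t i.
Definition trow d (x : 'rV[R]_d) : d.-tuple T := [tuple x 0%R i | i < d].

Lemma trowK d : cancel (@trow d) (@rowt d).
Proof. by move=> x; apply/rowP => i; rewrite mxE tnth_mktuple. Qed.

Lemma measurable_trow dd (X : measurableType dd) d (h : X -> 'rV[R]_d) :
  (forall i, measurable_fun setT (fun x => h x 0%R i : R)) ->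
  measurable_fun setT (fun x => trow (h x)).
Proof.
move=> mh; apply/measurable_fun_tnthP => i.
rewrite (_ : _ \o _ = fun x => h x 0%R i); first exact: mh.
by apply/funext => x /=; rewrite tnth_mktuple.
Qed.

Lemma measurable_rowt_coord d (i : 'I_d) :
  measurable_fun setT (fun t : d.-tuple T => rowt t 0%R i : R).
Proof. by under eq_fun do rewrite mxE; exact: measurable_tnth. Qed.

Lemma measurable_rowt_affine d m (A : 'M[R]_(d, m)) (v : 'rV[R]_m) i :
  measurable_fun setT (fun t : d.-tuple T => (rowt t *m A + v)%R 0%R i : R).
Proof.
under eq_fun do rewrite !mxE.
apply: measurable_funD => //; apply: measurable_funSum => j.
by apply: measurable_funM => //; exact: measurable_rowt_coord.
Qed.

Lemma measurable_affine d (A : 'M[R]_d) (v : 'rV[R]_d) :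
  measurable_fun setT (fun t : d.-tuple T => trow (rowt t *m A + v)%R).
Proof. by apply: measurable_trow => i; exact: measurable_rowt_affine. Qed.

Lemma measurable_tcons_r d (x : T) :
  measurable_fun setT (fun t : d.-tuple T => tcons (x, t)).
Proof.
apply: (measurableT_comp (measurable_tcons (d := d))).
exact: measurable_fun_pair.
Qed.

Lemma rowt_tcons d x (t : d.-tuple T) (v : 'rV[R]_d.+1) :
  trow (rowt (tcons (x, t)) + v)%R =
  tcons ((x + v 0 0)%R, trow (rowt t + \row_i v 0 (lift 0 i))%R).
Proof.
apply: eq_from_tnth => i; rewrite tnth_mktuple !mxE.
case: (unliftP ord0 i) => [j ->|->]; last by rewrite tnth0 (tnth0 _ (trow _)).
by rewrite !tnthS tnth_mktuple !mxE.
Qed.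

Lemma ge0_integral_tuple_shift d (v : 'rV[R]_d) (f : d.-tuple T -> \bar R) :
  measurable_fun setT f -> (forall x, 0 <= f x) ->
  \int[mu d]_t f (trow (rowt t + v)%R) = \int[mu d]_t f t.
Proof.
have mshift k (w : 'rV[R]_k) : measurable_fun setT (fun t : k.-tuple T => trow (rowt t + w)%R).
  apply: measurable_trow => i; under eq_fun do rewrite mxE.
  by apply: measurable_funD => //; exact: measurable_rowt_coord.
elim: d => [|d IH] in v f *; move=> mf f0;
    have mfv := measurableT_comp mf (mshift _ v).
  by rewrite !ge0_integral_tuple0//; congr f; apply: eq_from_tnth => -[].
rewrite !ge0_integral_tupleS//.
under eq_integral => x _.
  under eq_integral => t _ do rewrite rowt_tcons.
  rewrite (IH (\row_i v 0 (lift 0 i))%R (fun t => f (tcons ((x + v 0 0)%R, t))))//; last first.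
    by apply: measurableT_comp => //; exact: measurable_tcons_r.
  over.
apply: (@ge0_integral_shift R (v 0%R 0%R) (fun x => \int[mu d]_t f (tcons (x, t)))).
  apply: (measurable_fun_fubini_tonelli_F (m2 := mu d) (fun p => f (tcons p))) => [|p] //.
  by apply: measurableT_comp => //; exact: measurable_tcons.
by move=> x; exact: integral_ge0.
Qed.

Lemma measurable_tuple_box d (J : set T) : measurable J ->
  measurable [set t : d.-tuple T | forall i, J (tnth t i)].
Proof.
move=> mJ.
rewrite (_ : [set _ | _] = \bigcap_(i in [set: 'I_d]) ((fun t => tnth t i) @^-1` J)).
  apply: fin_bigcap_measurable => [|i _]; first exact: finite_finset.
  by rewrite -[X in measurable X]setTI; apply: measurable_tnth.
by apply/seteqP; split => [t h i _|t h i]; exact: h.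
Qed.

Lemma lebesgue_tuple_box d (J : set T) (c : R) : measurable J -> leb J = c%:E ->
  mu d [set t | forall i, J (tnth t i)] = (c ^+ d)%:E.
Proof.
move=> mJ Jc; elim: d => [|d IH].
  by rewrite /= diracE mem_set// => -[].
transitivity ((leb \x mu d) (J `*` [set t : d.-tuple T | forall i, J (tnth t i)])).
  congr (_ \x _); apply/seteqP; split => -[x t]/=.
    move=> h; split => [|i]; first by have := h ord0; rewrite /= tnth0.
    by have := h (lift ord0 i); rewrite /= tnthS.
  move=> [hx h] i; case: (unliftP ord0 i) => [j ->|->]; last by rewrite tnth0.
  by rewrite tnthS.
rewrite product_measure1E//; first by rewrite exprS EFinM -IH -Jc.
exact: measurable_tuple_box.
Qed.

Lemma measurable_comp_rowt dd (X : measurableType dd) d (g : 'rV[R]_d -> \bar R)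
    (h : X -> 'rV[R]_d) : measurable_fun setT (g \o @rowt d) ->
  (forall i, measurable_fun setT (fun x => h x 0%R i : R)) ->
  measurable_fun setT (g \o h).
Proof.
move=> mg mh; rewrite (_ : g \o h = (g \o @rowt d) \o (fun x => trow (h x))).
  by apply: measurableT_comp => //; exact: measurable_trow.
by apply/funext => x /=; rewrite trowK.
Qed.

Lemma measurable_rowt_mulmx dd (X : measurableType dd) d m (p : X -> d.-tuple T)
    (A : 'M[R]_(d, m)) i : measurable_fun setT p ->
  measurable_fun setT (fun x => (rowt (p x) *m A)%R 0%R i : R).
Proof.
move=> mp; under eq_fun do rewrite mxE.
apply: measurable_funSum => j; apply: measurable_funM => //.
exact: (measurableT_comp (measurable_rowt_coord j) mp).
Qed.

Lemma ge0_integral_row_shift d (v : 'rV[R]_d) (g : 'rV[R]_d -> \bar R) :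
  measurable_fun setT (g \o @rowt d) -> (forall x, 0 <= g x) ->
  \int[mu d]_t g (rowt t + v)%R = \int[mu d]_t g (rowt t).
Proof.
move=> mg g0.
have /= <- := ge0_integral_tuple_shift v mg (fun t => g0 (rowt t)).
by apply: eq_integral => t _; rewrite /= trowK.
Qed.

(** Both sides are translation-invariant functionals of [g], and such functionals are
    proportional: multiplying by the integral [1] of the indicator [k] of the cube
    [(-1, 0]^d], translations in each variable move the linear map [A] from the
    argument of [g] to that of [k]. *)
Lemma ge0_integral_row_linear d (A : 'M[R]_d) (g : 'rV[R]_d -> \bar R) :
  A \in unitmx -> measurable_fun setT (g \o @rowt d) -> (forall x, 0 <= g x) ->
  \int[mu d]_t g (rowt t *m A)%R =
  (\int[mu d]_t g (rowt t)) *
    mu d [set t | forall i, (0 <= (rowt t *m A) 0 i < 1)%R].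
Proof.
move=> uA mg g0.
pose J : set T := [set` `]-1, 0]%R].
pose K : set 'rV[R]_d := [set y | forall i, y 0%R i \in `]-1, 0]%R].
pose k y : \bar R := (\1_K y)%:E.
have k0 y : 0 <= k y by rewrite lee_fin.
have mK : measurable (@rowt d @^-1` K).
  rewrite (_ : _ @^-1` _ = [set t : d.-tuple T | forall i, J (tnth t i)]).
    by apply: measurable_tuple_box; exact: measurable_itv.
  by apply/seteqP; split => t h i; have := h i; rewrite /= mxE.
have mk : measurable_fun setT (k \o @rowt d).
  by apply/measurable_EFinP; apply: (measurable_indic mK).
have intk : \int[mu d]_t k (rowt t) = 1.
  rewrite (eq_integral (fun t => (\1_(@rowt d @^-1` K) t)%:E))// integral_indic// setIT.
  rewrite (_ : _ @^-1` _ = [set t : d.-tuple T | forall i, J (tnth t i)]).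
    apply: (etrans (@lebesgue_tuple_box d J 1 _ _)); last by rewrite expr1n.
      exact: measurable_itv.
    by rewrite lebesgue_measure_itv/= lte_fin ltrN10 -EFinD; congr (_%:E); ring.
  by apply/seteqP; split => t h i; have := h i; rewrite /= mxE.
have mcol dd (X : measurableType dd) (p q : X -> d.-tuple T) (B : 'M[R]_d) i :
    measurable_fun setT p -> measurable_fun setT q ->
    measurable_fun setT (fun x => (rowt (p x) *m B + rowt (q x))%R 0%R i : R).
  move=> mp mq; under eq_fun do rewrite mxE.
  apply: measurable_funD; first exact: measurable_rowt_mulmx.
  exact: (measurableT_comp (measurable_rowt_coord i) mq).
have mprod dd (X : measurableType dd) (h1 h2 : X -> 'rV[R]_d) :
    (forall i, measurable_fun setT (fun x => h1 x 0%R i : R)) ->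
    (forall i, measurable_fun setT (fun x => h2 x 0%R i : R)) ->
    measurable_fun setT (fun x => g (h1 x) * k (h2 x)).
  move=> m1 m2; apply: emeasurable_funM.
    exact: (measurable_comp_rowt mg m1).
  exact: (measurable_comp_rowt mk m2).
have mlin dd (X : measurableType dd) (p : X -> d.-tuple T) (B : 'M[R]_d) i :
    measurable_fun setT p ->
    measurable_fun setT (fun x => (rowt (p x) *m B)%R 0%R i : R).
  exact: measurable_rowt_mulmx.
have mcoord dd (X : measurableType dd) (p : X -> d.-tuple T) i :
    measurable_fun setT p -> measurable_fun setT (fun x => rowt (p x) 0%R i : R).
  by move=> mp; exact: (measurableT_comp (measurable_rowt_coord i) mp).
transitivity (\int[mu d]_x \int[mu d]_y (g (rowt x *m A)%R * k (rowt y))).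
  apply: eq_integral => x _; rewrite ge0_integralZl//.
  by rewrite intk mule1.
rewrite (fubini_tonelli (fun p => g (rowt p.1 *m A)%R * k (rowt p.2)))/=; last 2 first.
  by apply: mprod => i; [apply: mlin|apply: mcoord]; do ?[exact: measurable_fst|exact: measurable_snd].
  by move=> x; exact: mule_ge0.
(* translate [x] by the preimage of [y] *)
transitivity (\int[mu d]_y \int[mu d]_x (g (rowt x *m A + rowt y)%R * k (rowt y))).
  apply: eq_integral => y _.
  rewrite -(@ge0_integral_row_shift _ (rowt y *m invmx A)%R
     (fun x => g (x *m A)%R * k (rowt y))); last 2 first.
    by apply: mprod => i; [exact: mlin|exact: measurable_cst].
    by move=> x; exact: mule_ge0.
  by apply: eq_integral => x _; rewrite mulmxDl mulmxKV.
rewrite -(fubini_tonelli (fun p => g (rowt p.1 *m A + rowt p.2)%R * k (rowt p.2)))/=; last 2 first.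
  by apply: mprod => i; [apply: mcol|apply: mcoord]; do ?[exact: measurable_fst|exact: measurable_snd].
  by move=> x; exact: mule_ge0.
(* translate [y] by minus the image of [x] *)
transitivity (\int[mu d]_x \int[mu d]_y (g (rowt y) * k (rowt x *m (- A) + rowt y)%R)).
  apply: eq_integral => x _.
  rewrite -(@ge0_integral_row_shift _ (rowt x *m A)%R
     (fun y => g y * k (rowt x *m (- A) + y)%R)); last 2 first.
    apply: mprod => i; first exact: mcoord.
    by apply: (mcol _ _ (fun=> x) id).
    by move=> y; exact: mule_ge0.
  by apply: eq_integral => y _; rewrite mulmxN addrA addrAC addNr add0r [(_ + _)%R]addrC.
rewrite (fubini_tonelli (fun p => g (rowt p.2) * k (rowt p.1 *m (- A) + rowt p.2)%R))/=; last 2 first.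
  by apply: mprod => i; [apply: mcoord|apply: mcol]; do ?[exact: measurable_fst|exact: measurable_snd].
  by move=> x; exact: mule_ge0.
rewrite -ge0_integralZr//; apply: eq_integral => y _.
(* translate [x] back, which frees [k] from [y] *)
rewrite -(@ge0_integral_row_shift _ (rowt y *m invmx A)%R
   (fun x => g (rowt y) * k (x *m (- A) + rowt y)%R)); last 2 first.
  apply: mprod => i; first exact: measurable_cst.
  by apply: (mcol _ _ id (fun=> y)).
  by move=> x; exact: mule_ge0.
transitivity (\int[mu d]_x (g (rowt y) * k (rowt x *m - A)%R)).
  apply: eq_integral => x _.
  by rewrite mulmxDl !mulmxN mulmxKV// subrK.
rewrite ge0_integralZl//; last first.
  by apply: (measurable_comp_rowt mk) => i; exact: mlin.
congr (_ * _).
rewrite (_ : [set _ | _] = (fun x => (rowt x *m - A)%R) @^-1` K).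
  rewrite (eq_integral (fun t => (\1_((fun x => (rowt x *m - A)%R) @^-1` K) t)%:E))//.
  rewrite integral_indic ?setIT//.
  rewrite (_ : _ @^-1` _ = (fun t => trow (rowt t *m - A)%R) @^-1` (@rowt d @^-1` K)).
    rewrite -[X in measurable X]setTI.
    by apply: (measurable_trow (h := fun t => (rowt t *m - A)%R)) => // i; exact: mlin.
  by apply/seteqP; split => x /=; rewrite trowK.
have E (x : d.-tuple T) i : (rowt x *m - A)%R 0%R i = (- (rowt x *m A) 0 i)%R.
  by rewrite mulmxN mxE.
apply/seteqP; split => x /= h i; have := h i; rewrite in_itv/= E; lra.
Qed.

End LebesgueTuple.

(** * Truncated powers on half-lines and orthants *)
Section TruncatedPower.
Variable R : realType.
Local Notation T := (measurableTypeR R).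
Local Notation leb := (@lebesgue_measure R).

(** Unlike powers, truncated powers are integrable on the half-lines where their
    argument decreases, and integration only raises the exponent; the case [k = 0]
    is the indicator of the nonnegative half-line. *)
Definition tpow k (x : R) : R := if 0 <= x then x ^+ k else 0.

Lemma tpow_ge0 k x : 0 <= tpow k x.
Proof. by rewrite /tpow; case: ifP => // x0; exact: exprn_ge0. Qed.

Lemma measurable_tpow k : measurable_fun [set: R] (tpow k).
Proof.
apply: measurable_fun_ifT => //.
by apply: measurable_fun_ler.
Qed.

Lemma integral_tpow_itv k (h c : R) : 0 < c -> 0 <= h ->
  (\int[leb]_(t in `[0%R, (h / c)%R]) ((h - c * t) ^+ k)%:E =
   (h ^+ k.+1 / (k.+1%:R * c))%:E)%E.
Proof.
move=> c0; rewrite le_eqVlt => /predU1P[<-|h0].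
  by rewrite mul0r set_itv1 integral_set1 expr0n mul0r.
have k0 : k.+1%:R != 0 :> R by rewrite pnatr_eq0.
pose F (t : R) : R := - (h - c * t) ^+ k.+1 / (k.+1%:R * c).
have dF (x : R) : is_derive x 1 F ((h - c * x) ^+ k).
  have d1 : is_derive x 1 (cst h - c \*: id) (0 - c *: 1) by exact: is_deriveB.
  have := is_deriveZ (- (k.+1%:R * c)^-1) (is_deriveX k.+1 d1).
  rewrite (_ : _ \*: _ = F); last first.
    apply/funext => t; rewrite /F /= fctE /GRing.scale/=.
    by rewrite (_ : (cst h - c \*: id) t = h - c * t)//; ring.
  move=> dF; apply: (is_derive_eq dF); rewrite /GRing.scale/= sub0r mulr1.
  rewrite (_ : (cst h - c \*: id) x = h - c * x)//.
  by move: (k.+1%:R : R) k0 => N N0 /=; field; rewrite N0 gt_eqF.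
have cF x : {for x, continuous F}.
  apply: differentiable_continuous; apply/derivable1_diffP.
  exact: (@ex_derive _ _ _ _ _ _ _ (dF x)).
rewrite (@continuous_FTC2 _ _ F).
- rewrite -EFinB /F mulr0 subr0 [c * _]mulrC divfK ?gt_eqF// subrr expr0n/=.
  by congr (_%:E); move: (k.+1%:R : R) k0 => N N0; field; rewrite N0 gt_eqF.
- by rewrite divr_gt0.
- apply: continuous_subspaceT => x.
  apply: (@cvg_comp _ _ _ (fun t => h - c * t) (fun y => y ^+ k) _ (nbhs (h - c * x))).
    by apply: cvgB; [exact: cvg_cst|exact: mulrl_continuous].
  exact: exprn_continuous.
- split => [x _||] //.
    exact: cvg_at_right_filter (cF 0).
  exact: cvg_at_left_filter (cF (h / c)).
- by move=> x _; rewrite derive1E; apply: derive_val.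
Qed.

Lemma measurable_pos_indic (b : R -> bool) : (forall t, t != 0 -> b t = (0 < t)) ->
  measurable_fun [set: T] (fun t : T => (b t)%:R : R).
Proof.
move=> bE; have [b0|b0] := boolP (b 0).
  rewrite (_ : (fun t => _) = fun t : T => if 0 <= t then 1 else 0).
    by apply: measurable_fun_ifT => //; apply: measurable_fun_ler.
  apply/funext => t; have [->|t0] := eqVneq t 0; first by rewrite b0 lexx.
  by rewrite bE// le_eqVlt eq_sym (negbTE t0)/=; case: ifP.
rewrite (_ : (fun t => _) = fun t : T => if 0 < t then 1 else 0).
  by apply: measurable_fun_ifT => //; apply: measurable_fun_ltr.
apply/funext => t; have [->|t0] := eqVneq t 0; first by rewrite (negbTE b0) ltxx.
by rewrite bE//; case: ifP.
Qed.

(** Leaving [b] free at the origin treats half-lines with and without their end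
    point together. *)
Lemma integral_tpow_pos k (h c : R) (b : R -> bool) : 0 < c ->
  (forall t, t != 0 -> b t = (0 < t)) ->
  (\int[leb]_t ((b t)%:R * tpow k (h - c * t))%:E =
   (tpow k.+1 h / (k.+1%:R * c))%:E)%E.
Proof.
move=> c0 bE; have mb := measurable_pos_indic bE.
have mtp : measurable_fun [set: T] (fun t : T => tpow k (h - c * t)).
  apply: (measurableT_comp (measurable_tpow k)).
  by apply: measurable_funB => //; apply: measurable_funM.
transitivity (\int[leb]_t ((0 <= t)%R%:R * tpow k (h - c * t))%:E)%E.
  apply: ge0_ae_eq_integral => //.
  - by apply/measurable_EFinP; apply: measurable_funM.
  - apply/measurable_EFinP; apply: measurable_funM => //.
    rewrite (_ : (fun t => _) = fun t : T => if 0 <= t then 1 else 0).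
      by apply: measurable_fun_ifT => //; apply: measurable_fun_ler.
    by apply/funext => t; case: ifP.
  - by move=> t _; rewrite lee_fin mulr_ge0// tpow_ge0.
  - by move=> t _; rewrite lee_fin mulr_ge0// tpow_ge0.
  exists [set 0]; split => //; first exact: lebesgue_measure_set1.
  move=> t /= /not_implyP[_]; apply: contra_notP => /eqP t0.
  by rewrite bE// le_eqVlt eq_sym (negbTE t0).
have [h0|h0] := leP 0 h; last first.
  rewrite {2}/tpow leNgt h0/= mul0r; apply: integral0_eq => t _.
  rewrite /tpow; case: leP => t0; rewrite ?mul0r//.
  suff -> : (0 <= h - c * t) = false by rewrite mulr0.
  by have ct0 := mulr_ge0 (ltW c0) t0; apply/negbTE; rewrite -ltNge; lra.
rewrite {2}/tpow h0 -integral_tpow_itv//.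
rewrite [RHS]integral_mkcond; apply: eq_integral => t _.
rewrite patchE mem_setE in_itv/= ler_pdivlMr// /tpow [t * c]mulrC subr_ge0.
by case: (0 <= t); case: (_ <= h); rewrite ?mul1r ?mulr0 ?mul0r.
Qed.

Lemma ge0_integral_opp (f : T -> \bar R) :
  measurable_fun setT f -> (forall x, 0 <= f x)%E ->
  (\int[leb]_x f (- x)%R = \int[leb]_x f x)%E.
Proof.
have mN : measurable_fun [set: T] (fun x : T => (- x)%R : T) by exact: oppr_measurable.
move=> mf f0; rewrite -[RHS](_ : \int[pushforward leb ((fun x => - x)%R : R -> T)]_x f x = _)%E.
  by rewrite ge0_integral_pushforward.
by apply: eq_measure_integral => A mA _; exact: lebesgue_measureN.
Qed.

Lemma measurable_half_indic (c : R) (b : R -> bool) : c != 0 ->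
  (forall t, t != 0 -> b t = (c * t < 0)) ->
  measurable_fun [set: T] (fun t : T => (b t)%:R : R).
Proof.
move=> c0 bE; have [c_gt0|c_lt0|/eqP] := ltgtP c 0; last by rewrite (negbTE c0).
  by apply: measurable_pos_indic => t t0; rewrite bE// nmulr_rlt0.
rewrite (_ : (fun t => _) = (fun t => (b (- t))%:R) \o (-%R : T -> T)).
  apply: measurableT_comp; last exact: oppr_measurable.
  apply: measurable_pos_indic => t t0.
  by rewrite bE ?oppr_eq0// mulrN oppr_lt0 pmulr_rgt0.
by apply/funext => t /=; rewrite opprK.
Qed.

Lemma integral_tpow_half k (h c : R) (b : R -> bool) : c != 0 ->
  (forall t, t != 0 -> b t = (c * t < 0)) ->
  (\int[leb]_t ((b t)%:R * tpow k (h + c * t))%:E =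
   (tpow k.+1 h / (k.+1%:R * `|c|))%:E)%E.
Proof.
move=> c0 bE; have [c_gt0|c_lt0|/eqP] := ltgtP c 0; last by rewrite (negbTE c0).
  rewrite ltr0_norm// -(@integral_tpow_pos _ _ _ b) ?oppr_gt0//.
    by apply: eq_integral => t _; rewrite mulNr opprK.
  by move=> t t0; rewrite bE// nmulr_rlt0.
rewrite gtr0_norm// -(@integral_tpow_pos _ _ _ (fun t => b (- t)))//; last first.
  by move=> t t0; rewrite bE ?oppr_eq0// mulrN oppr_lt0 pmulr_rgt0.
rewrite -ge0_integral_opp; first by apply: eq_integral => t _; rewrite mulrN.
  apply/measurable_EFinP; apply: measurable_funM.
    exact: measurable_half_indic bE.
  apply: (measurableT_comp (measurable_tpow k)).
  by apply: measurable_funD => //; apply: measurable_funM.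
by move=> t; rewrite lee_fin mulr_ge0// tpow_ge0.
Qed.

Local Notation mu d := (lebesgue_tuple R d).

(** Iterating the one-dimensional formula raises the exponent once for each
    coordinate. *)
Lemma integral_tpow_orthant d k (h : R) (c : 'I_d -> R) (b : 'I_d -> R -> bool) :
  (forall i, c i != 0) -> (forall i t, t != 0 -> b i t = (c i * t < 0)) ->
  (\int[mu d]_t ((\prod_i (b i (tnth t i))%:R) *
                 tpow k (h + \sum_i c i * tnth t i))%:E =
   (k`!%:R / (k + d)`!%:R * tpow (k + d) h / \prod_i `|c i|)%:E)%E.
Proof.
have mint d' k' h' (c' : 'I_d' -> R) (b' : 'I_d' -> R -> bool) :
    (forall i, c' i != 0) -> (forall i t, t != 0 -> b' i t = (c' i * t < 0)) ->
    measurable_fun [set: d'.-tuple T] (fun t => ((\prod_i (b' i (tnth t i))%:R) *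
                 tpow k' (h' + \sum_i c' i * tnth t i))%:E).
  move=> c0 bE; apply/measurable_EFinP; apply: measurable_funM.
    apply: measurable_funProd => i.
    apply: (measurableT_comp (f := fun t : T => (b' i t)%:R : R)).
      exact: measurable_half_indic (bE i).
    exact: measurable_tnth.
  apply: (measurableT_comp (measurable_tpow k')).
  apply: measurable_funD => //; apply: measurable_funSum => i.
  by apply: measurable_funM => //; exact: measurable_tnth.
elim: d => [|d IH] in h c b *; move=> c0 bE.
  rewrite ge0_integral_tuple0//; last first.
  - by move=> t; rewrite lee_fin mulr_ge0 ?prodr_ge0// tpow_ge0.
  - exact: mint.
  have k0 : k`!%:R != 0 :> R by rewrite pnatr_eq0 -lt0n fact_gt0.
  by rewrite !big_ord0 addn0 mul1r addr0 divr1 divff// mul1r.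
rewrite ge0_integral_tupleS//; last first.
  by move=> t; rewrite lee_fin mulr_ge0 ?prodr_ge0// tpow_ge0.
  exact: mint.
pose K : R := k`!%:R / (k + d)`!%:R / \prod_(i < d) `|c (lift ord0 i)|.
have K0 : 0 <= K by rewrite !mulr_ge0 ?invr_ge0 ?prodr_ge0.
transitivity (\int[leb]_x (K%:E * ((b ord0 x)%:R * tpow (k + d) (h + c ord0 * x))%:E))%E.
  apply: eq_integral => x _.
  transitivity (((b ord0 x)%:R)%:E * \int[mu d]_t
     ((\prod_i (b (lift ord0 i) (tnth t i))%:R) *
       tpow k ((h + c ord0 * x) + \sum_i c (lift ord0 i) * tnth t i))%:E)%E.
    rewrite -ge0_integralZl//.
    - apply: eq_integral => t _; rewrite !big_ord_recl -EFinM !tnth0 mulrA addrA.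
      have E i : tnth (tcons (x, t)) (lift ord0 i) = tnth t i by rewrite tnthS.
      congr ((_ * _ * tpow k (_ + _))%:E); first by apply: eq_bigr => i _; rewrite E.
      by apply: eq_bigr => i _; rewrite E.
    - by apply: (@mint d k _ (fun i => c (lift ord0 i)) (fun i => b (lift ord0 i))) => i; [exact: c0|exact: bE].
    - by move=> t _; rewrite lee_fin mulr_ge0 ?prodr_ge0// tpow_ge0.
  rewrite (IH _ (fun i => c (lift ord0 i)) (fun i => b (lift ord0 i)))=> [|i|i]; [|exact: c0|exact: bE].
  by rewrite -!EFinM; congr (_%:E); rewrite /K; ring.
rewrite ge0_integralZl//.
- rewrite integral_tpow_half; [|exact: c0|exact: bE].
  rewrite -EFinM addnS big_ord_recl factS natrM /K; congr (_%:E).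
  rewrite !invfM; ring.
- apply/measurable_EFinP; apply: measurable_funM.
    exact: measurable_half_indic (bE ord0).
  apply: (measurableT_comp (measurable_tpow _)).
  by apply: measurable_funD => //; apply: measurable_funM.
- by move=> t _; rewrite lee_fin mulr_ge0// tpow_ge0.
Qed.

End TruncatedPower.

(** * Integrals over simplicial cones *)
Section DotProduct.
Variables (R : realType) (n : nat).
Implicit Types (x y z v : 'rV[R]_n).

Lemma normr_coord x i : `|x 0 i| <= `|x|.
Proof.
rewrite [leRHS]/Num.norm/= mx_normrE.
exact: (le_bigmax _ (fun j => `|x j.1 j.2|) (0, i)).
Qed.

Lemma exists_small_scale (e : R) v : 0 < e -> exists2 c, 0 < c & `|c *: v| < e.
Proof.
move=> e0; have v1 : 0 < 1 + `|v| by rewrite ltr_wpDr.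
have c0 : 0 < e / (1 + `|v|) / 2 by rewrite !divr_gt0.
exists (e / (1 + `|v|) / 2) => //; rewrite normrZ gtr0_norm//.
by rewrite mulrAC ltr_pdivrMr// mulrAC ltr_pdivrMr// -mulrA ltr_pM2l//; lra.
Qed.

Lemma dotpC x y : dotp x y = dotp y x.
Proof. by apply: eq_bigr => i _; rewrite mulrC. Qed.

Lemma dotpDr x y z : dotp x (y + z) = dotp x y + dotp x z.
Proof. by rewrite -big_split; apply: eq_bigr => i _; rewrite mxE mulrDr. Qed.

Lemma dotpDl x y z : dotp (x + y) z = dotp x z + dotp y z.
Proof. by rewrite dotpC dotpDr !(dotpC z). Qed.

Lemma dotpZr a x y : dotp x (a *: y) = a * dotp x y.
Proof. by rewrite mulr_sumr; apply: eq_bigr => i _; rewrite mxE mulrCA. Qed.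

Lemma dotpZl a x y : dotp (a *: x) y = a * dotp x y.
Proof. by rewrite dotpC dotpZr dotpC. Qed.

Lemma dotpNr x y : dotp x (- y) = - dotp x y.
Proof. by rewrite -scaleN1r dotpZr mulN1r. Qed.

Lemma dotpNl x y : dotp (- x) y = - dotp x y.
Proof. by rewrite dotpC dotpNr dotpC. Qed.

Lemma dotp0r x : dotp x 0 = 0.
Proof. by rewrite -(scale0r 0) dotpZr mul0r. Qed.

Lemma dotpBr x y z : dotp x (y - z) = dotp x y - dotp x z.
Proof. by rewrite dotpDr dotpNr. Qed.

Lemma dotp_mulmx m x (t : 'rV[R]_m) (u : 'M[R]_(m, n)) :
  dotp x (t *m u) = \sum_i t 0 i * dotp x (row i u).
Proof.
rewrite /dotp; under eq_bigr => j _ do rewrite mxE mulr_sumr.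
rewrite exchange_big; apply: eq_bigr => i _; rewrite mulr_sumr.
by apply: eq_bigr => j _; rewrite mxE mulrCA.
Qed.

Lemma dotpxx_gt0 x : x != 0 -> 0 < dotp x x.
Proof.
move=> x0; rewrite lt_neqAle eq_sym sumr_ge0 ?andbT => [|i _]; last exact: sqr_ge0.
apply: contra x0 => /eqP xx0; apply/eqP/rowP => i; rewrite mxE.
move/eqP: xx0; rewrite psumr_eq0 => [|j _]; last exact: sqr_ge0.
by move/allP/(_ i); rewrite mem_index_enum => /(_ isT); rewrite mulf_eq0 orbb => /eqP.
Qed.

End DotProduct.

Section Cone.
Variables (R : realType) (d : nat).
Local Notation T := (measurableTypeR R).
Local Notation mu := (lebesgue_tuple R d).
Implicit Types (u : 'M[R]_d) (s l x : 'rV[R]_d).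

Definition cone_coord s u x : 'rV[R]_d := (x - s) *m invmx u.

Lemma cone_coordK s u x : u \in unitmx -> x = s + cone_coord s u x *m u.
Proof. by move=> uu; rewrite mulmxKV// addrC subrK. Qed.

(** The volume of the half-open parallelepiped spanned by the rows of [u]. *)
Definition frame_vol u : R :=
  fine (mu [set t | forall i, 0 <= (rowt t *m invmx u) 0 i < 1]).

Lemma measurable_dotp l (h : R) :
  measurable_fun setT (fun t : d.-tuple T => dotp l (rowt t) + h : R).
Proof.
apply: measurable_funD => //; apply: measurable_funSum => i.
by apply: measurable_funM => //; exact: measurable_rowt_coord.
Qed.

Lemma bounded_mu_lty (A : set (d.-tuple T)) (K : R) : measurable A ->
  (forall t, A t -> forall i, `|rowt t 0 i| <= K) -> (mu A < +oo)%E.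
Proof.
move=> mA AK; pose J : set T := `[- K, K]%classic.
apply: (@le_lt_trans _ _ (mu [set t : d.-tuple T | forall i, J (tnth t i)])).
  apply: le_measure; rewrite ?inE//.
    by apply: measurable_tuple_box; exact: measurable_itv.
  by move=> t /AK + i => /(_ i); rewrite mxE ler_norml /J/= in_itv.
apply: (@le_lt_trans _ _ ((Num.max 0 (K - - K)) ^+ d)%:E); last by rewrite ltry.
rewrite le_eqVlt; apply/orP; left; apply/eqP.
apply: lebesgue_tuple_box; first exact: measurable_itv.
rewrite lebesgue_measure_itv/= lte_fin -EFinB.
by case: ltP => h; congr (_%:E); rewrite maxC maxEle; case: lerP => //; lra.
Qed.

Lemma rowt_mul_bounded u : exists K : R, forall x, (forall i, 0 <= (x *m invmx u) 0 i < 1) ->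
  u \in unitmx -> forall i, `|x 0 i| <= K.
Proof.
exists (\sum_i \sum_j `|u j i|) => x h uu i.
rewrite -(mulmxKV uu x) mxE (le_trans (ler_norm_sum _ _ _))//.
apply: (@le_trans _ _ (\sum_j `|u j i|)); last first.
  by rewrite [leRHS](bigD1 i)//= lerDl; apply: sumr_ge0 => *; apply: sumr_ge0.
apply: ler_sum => j _; have /andP[h0 h1] := h j.
by rewrite normrM ler_piMl// ger0_norm// ltW.
Qed.

Lemma measurable_frame u : measurable [set t : d.-tuple T | forall i, 0 <= (rowt t *m u) 0 i < 1].
Proof.
pose J : set T := [set` `[0, 1[%R].
rewrite (_ : [set _ | _] =
    (fun t => trow (rowt t *m u + 0)) @^-1` [set t | forall i, J (tnth t i)]).
  rewrite -[X in measurable X]setTI; apply: measurable_affine => //.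
  by apply: measurable_tuple_box; exact: measurable_itv.
apply/seteqP; split => t h i; have := h i;
  by rewrite /J/= tnth_mktuple addr0 in_itv.
Qed.

Lemma frame_volE u : u \in unitmx ->
  mu [set t | forall i, 0 <= (rowt t *m invmx u) 0 i < 1] = (frame_vol u)%:E.
Proof.
move=> uu; rewrite fineK// ge0_fin_numE//.
have [K hK] := rowt_mul_bounded u.
apply: (@bounded_mu_lty _ K); first exact: measurable_frame.
by move=> t h i; exact: (hK _ h uu i).
Qed.

Definition cone_weight s u (b : 'I_d -> R -> bool) x : R :=
  \prod_i (b i (cone_coord s u x 0 i))%:R.

Lemma measurable_cone_coord s u i :
  measurable_fun setT (fun t : d.-tuple T => cone_coord s u (rowt t) 0 i : R).
Proof.
rewrite (_ : (fun t => _) = fun t => (rowt t *m invmx u + (- s *m invmx u)) 0 i).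
  exact: measurable_rowt_affine.
by apply/funext => t; rewrite /cone_coord mulmxBl mulNmx.
Qed.

Lemma measurable_cone_weight s u b (c : 'I_d -> R) : (forall i, c i != 0) ->
  (forall i t, t != 0 -> b i t = (c i * t < 0)) ->
  measurable_fun setT (fun t : d.-tuple T => cone_weight s u b (rowt t) : R).
Proof.
move=> c0 bE; apply: measurable_funProd => i.
apply: (measurableT_comp (f := fun t : T => (b i t)%:R : R)).
  exact: measurable_half_indic (c0 i) (bE i).
exact: measurable_cone_coord.
Qed.

(** The indicators [b] select the coordinates along which [l] decreases, so that the
    integral over the cone converges. *)
Lemma integral_tpow_cone k s u l (h : R) b : u \in unitmx ->
  (forall i, dotp l (row i u) != 0) ->
  (forall i t, t != 0 -> b i t = (dotp l (row i u) * t < 0)) ->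
  (\int[mu]_t (cone_weight s u b (rowt t) * tpow k (dotp l (rowt t) + h))%:E =
   (k`!%:R / (k + d)`!%:R * frame_vol u * tpow (k + d) (dotp l s + h) /
    \prod_i `|dotp l (row i u)|)%:E)%E.
Proof.
move=> uu c0 bE.
pose g (z : 'rV[R]_d) : \bar R := ((\prod_i (b i (z 0 i))%:R) *
   tpow k (dotp l s + h + \sum_i dotp l (row i u) * z 0 i))%:E.
have g0 z : (0 <= g z)%E by rewrite lee_fin mulr_ge0 ?prodr_ge0// tpow_ge0.
have mg : measurable_fun setT (g \o @rowt R d).
  apply/measurable_EFinP; apply: measurable_funM.
    apply: measurable_funProd => i.
    apply: (measurableT_comp (f := fun t : T => (b i t)%:R : R)).
      exact: measurable_half_indic (c0 i) (bE i).
    exact: measurable_rowt_coord.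
  apply: (measurableT_comp (measurable_tpow k)).
  apply: measurable_funD => //; apply: measurable_funSum => i.
  by apply: measurable_funM => //; exact: measurable_rowt_coord.
transitivity (\int[mu]_t g ((rowt t - s) *m invmx u))%E.
  apply: eq_integral => t _; congr (_ * tpow _ _)%:E.
  rewrite {1}(cone_coordK s (rowt t) uu) dotpDr dotp_mulmx -!addrA; congr (_ + _).
  by rewrite addrC; congr (_ + _); apply: eq_bigr => i _; rewrite mulrC.
rewrite (@ge0_integral_row_shift _ _ (- s) (fun x => g (x *m invmx u))); last 2 first.
- by apply: (measurable_comp_rowt mg) => i; apply: measurable_rowt_mulmx.
- by move=> x; exact: g0.
rewrite ge0_integral_row_linear ?unitmx_inv// frame_volE//.
transitivity ((k`!%:R / (k + d)`!%:R * tpow (k + d) (dotp l s + h) /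
    \prod_i `|dotp l (row i u)|)%:E * (frame_vol u)%:E)%E; last first.
  by rewrite -EFinM; congr (_%:E); ring.
congr (_ * _)%E; rewrite -(integral_tpow_orthant k _ c0 bE).
apply: eq_integral => t _; rewrite /g; congr ((_ * tpow _ (_ + _))%:E).
  by apply: eq_bigr => i _; rewrite mxE.
by apply: eq_bigr => i _; rewrite mxE.
Qed.

End Cone.

Section NullHyperplane.
Variable R : realType.
Local Notation T := (measurableTypeR R).
Local Notation mu d := (lebesgue_tuple R d).

Lemma measurable_hyperplane d (c : 'rV[R]_d) (h : R) :
  measurable [set t : d.-tuple T | dotp c (rowt t) = h].
Proof.
have := measurable_dotp c 0 measurableT (measurable_set1 h).
rewrite setTI; congr measurable; apply/seteqP; split => t /=; rewrite addr0//.
Qed.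

(** If the first coefficient of [c] vanishes the hyperplane is a product with a
    hyperplane of smaller dimension; otherwise its sections along the first axis are
    points. *)
Lemma null_hyperplane d (c : 'rV[R]_d) (h : R) : c != 0 ->
  mu d [set t | dotp c (rowt t) = h] = 0%E.
Proof.
elim: d => [|d IH] in c h *; first by rewrite (thinmx0 c) eqxx.
move=> c0.
transitivity (\int[mu d.+1]_t (\1_[set t | dotp c (rowt t) = h] t)%:E)%E.
  by rewrite integral_indic ?setIT//; exact: measurable_hyperplane.
rewrite ge0_integral_tupleS; last 2 first.
- by apply/measurable_EFinP; apply: measurable_indic; exact: measurable_hyperplane.
- by move=> t; rewrite lee_fin.
pose c' : 'rV[R]_d := \row_i c 0 (lift ord0 i).
have cE (x : R) (t : d.-tuple T) : dotp c (rowt (tcons (x, t))) = c 0 ord0 * x + dotp c' (rowt t).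
  rewrite /dotp big_ord_recl !mxE tnth0; congr (_ + _); apply: eq_bigr => i _.
  by rewrite !mxE tnthS.
have iE x t : (\1_[set t | dotp c (rowt t) = h] (tcons (x, t)) =
    \1_[set t | dotp c' (rowt t) = h - c 0 ord0 * x] t :> R).
  rewrite !indicE; congr ((nat_of_bool _)%:R); apply/idP/idP; rewrite !inE/= cE; lra.
have [c'0|c'0] := eqVneq c' 0; last first.
  apply: integral0_eq => x _; under eq_integral do rewrite iE.
  rewrite integral_indic ?setIT//; last exact: measurable_hyperplane.
  exact: IH.
have c00 : c 0 ord0 != 0.
  apply: contra c0 => /eqP c00; apply/eqP/rowP => i; rewrite mxE.
  case: (unliftP ord0 i) => [j ->|->//].
  by have /rowP/(_ j) := c'0; rewrite !mxE.
rewrite (fubini_tonelli (fun p => (\1_[set t | dotp c (rowt t) = h] (tcons p))%:E)); last 2 first.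
- apply: (measurableT_comp (f := fun t => (\1_[set t | dotp c (rowt t) = h] t)%:E)).
    by apply/measurable_EFinP; apply: measurable_indic; exact: measurable_hyperplane.
  exact: measurable_tcons.
- by move=> t; rewrite lee_fin.
apply: integral0_eq => t _.
transitivity (\int[@lebesgue_measure R]_(x in [set: T]) (\1_[set (h / c 0 ord0)%R : T] x)%:E)%E.
  apply: eq_integral => x _; rewrite iE c'0 !indicE; congr ((nat_of_bool _)%:R%:E).
  apply/idP/idP; rewrite !inE/=.
    by rewrite dotpC dotp0r => /esym/subr0_eq ->; rewrite mulrC mulKf.
  by move=> ->; rewrite dotpC dotp0r mulrCA divff// mulr1 subrr.
rewrite integral_indic//.
by rewrite setIT; exact: lebesgue_measure_set1.
Qed.

End NullHyperplane.

(** * Functions locally invariant along directions *)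
Section LocalVanishing.
Variables (R : realType) (d : nat).
Local Notation E := 'rV[R]_d.
Implicit Types (l p x v w : E) (f g : E -> R) (vs : seq E).

Definition dotp_bound l : R := 1 + \sum_i `|l 0 i|.

Lemma dotp_bound_gt0 l : 0 < dotp_bound l.
Proof. by rewrite ltr_wpDr// sumr_ge0. Qed.

Lemma normr_dotp l x : `|dotp l x| <= dotp_bound l * `|x|.
Proof.
rewrite (le_trans (ler_norm_sum _ _ _))// mulrDl mul1r ler_wpDl// mulr_suml.
by apply: ler_sum => i _; rewrite normrM ler_wpM2l// normr_coord.
Qed.

Lemma continuous_dotp l : continuous (dotp l : E -> R).
Proof.
move=> x; apply/(@cvgrPdist_lt _ _ _ (nbhs x)) => e e0.
apply/nbhs_ballP; exists (e / dotp_bound l); first by rewrite /= divr_gt0// dotp_bound_gt0.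
move=> y; rewrite -ball_normE/= ltr_pdivlMr ?dotp_bound_gt0// mulrC -dotpBr.
exact/le_lt_trans/normr_dotp.
Qed.

(** [h] is bounded by the same radius as [x - p] only to have one parameter. *)
Definition loc_inv p (e : R) v f :=
  forall x h, `|x - p| < e -> `|h| < e -> f (x + h *: v) = f x.

(** Near [p], [f] is a sum of functions locally invariant along the successive
    directions [vs]. *)
Fixpoint split_inv p (e : R) vs f : Prop :=
  if vs is v :: vs' then
    exists2 g, loc_inv p e v g & split_inv p e vs' (fun x => f x - g x)
  else forall x, `|x - p| < e -> f x = 0.

Lemma split_inv_ext p e vs f g : (forall x, `|x - p| < e -> f x = g x) ->
  split_inv p e vs f -> split_inv p e vs g.
Proof.
elim: vs f g => [|v vs IH] f g fg /=; first by move=> f0 x xp; rewrite -fg// f0.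
by move=> [g0 g0v fs]; exists g0 => //; apply: IH fs => x xp; rewrite fg.
Qed.

Lemma split_inv_le p e e' vs f : e' <= e -> split_inv p e vs f -> split_inv p e' vs f.
Proof.
move=> ee'; elim: vs f => [|v vs IH] f /=.
  by move=> f0 x xp; apply/f0/(lt_le_trans xp).
move=> [g gv fg]; exists g; last exact: IH.
by move=> x h xp hp; apply: gv; apply: lt_le_trans ee'.
Qed.

Lemma split_invD p e vs ws f g : split_inv p e vs f -> split_inv p e ws g ->
  split_inv p e (vs ++ ws) (fun x => f x + g x).
Proof.
elim: vs f => [|v vs IH] f /= fs gs.
  by apply: split_inv_ext gs => x xp; rewrite fs// add0r.
have [g0 g0v fg0] := fs; exists g0 => //.
by apply: split_inv_ext (IH _ fg0 gs) => x _; rewrite addrAC.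
Qed.

Lemma split_invN p e vs f : split_inv p e vs f -> split_inv p e vs (fun x => - f x).
Proof.
elim: vs f => [|v vs IH] f /=; first by move=> f0 x /f0 ->; rewrite oppr0.
move=> [g gv fg]; exists (fun x => - g x); first by move=> x h xp hp; rewrite gv.
by apply: split_inv_ext (IH _ fg) => x _; rewrite opprB opprK addrC.
Qed.

Lemma split_inv_shift p e vs f w : `|w| <= e / 2 -> split_inv p e vs f ->
  split_inv p (e / 2) vs (fun x => f (x + w) - f x).
Proof.
move=> we.
have ball x : `|x - p| < e / 2 -> `|x + w - p| < e.
  by move=> xp; rewrite addrAC (le_lt_trans (ler_normD _ _))//; lra.
have ball2 x : `|x - p| < e / 2 -> `|x - p| < e.
  by move=> xp; have := normr_ge0 (x - p); lra.
elim: vs f => [|v vs IH] f /=.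
  by move=> f0 x xp; rewrite (f0 _ (ball _ xp)) (f0 _ (ball2 _ xp)) subr0.
move=> [g gv fg]; exists (fun x => g (x + w) - g x).
  move=> x h xp hp; have he : `|h| < e by have := normr_ge0 h; lra.
  by rewrite [x + _ + w]addrAC (gv _ _ (ball _ xp) he) (gv _ _ (ball2 _ xp) he).
by apply: split_inv_ext (IH _ fg) => x _; ring.
Qed.

(** By induction on the number of directions: subtracting from [f] a small translate
    of it along the first direction leaves a sum with one term less, which vanishes
    near [p]; and the translate of a point close enough to [p] lies in the
    half-space where [f] vanishes. The radius [e'] does not depend on [f], because
    the induction hypothesis is used for a function that depends on the
    translation. *)
Lemma local_vanishing l p vs e : 0 < e -> {in vs, forall v, dotp l v != 0} ->
  exists2 e', 0 < e' & forall f, split_inv p e vs f ->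
    (forall x, `|x - p| < e -> dotp l p < dotp l x -> f x = 0) ->
    forall x, `|x - p| < e' -> f x = 0.
Proof.
elim: vs e => [|v vs IH] e e0 lvs; first by exists e.
have e20 : 0 < e / 2 by rewrite divr_gt0.
have [|e1 e10 He1] := IH _ e20.
  by move=> v' v'vs; apply: lvs; rewrite inE v'vs orbT.
have lv0 : dotp l v != 0 by apply: lvs; rewrite mem_head.
pose eta := e / 2 / (1 + `|v|).
have v1 : 0 < 1 + `|v| by rewrite ltr_wpDr.
have eta0 : 0 < eta by rewrite divr_gt0.
pose h := Num.sg (dotp l v) * eta.
have hE : `|h| = eta by rewrite normrM normr_sg lv0 mul1r gtr0_norm.
pose w := h *: v.
have we : `|w| <= e / 2.
  by rewrite normrZ hE /eta mulrAC ler_pdivrMr// ler_wpM2l ?(ltW e20)// lerDr.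
have lw : 0 < dotp l w.
  by rewrite dotpZr /h mulrAC -normrEsg mulr_gt0// normr_gt0.
have he : `|h| < e.
  rewrite hE; apply: (@le_lt_trans _ _ (e / 2)); last lra.
  by rewrite /eta ler_pdivrMr// ler_peMr ?(ltW e20)// lerDl.
exists (Num.min e1 (Num.min (e / 2) (dotp l w / dotp_bound l))).
  by rewrite !lt_min e10 e20 divr_gt0// dotp_bound_gt0.
move=> f [g gv fg] f0 x; rewrite !lt_min => /and3P[xe1 xe2 xl].
have ball y : `|y - p| < e / 2 -> `|y + w - p| < e.
  by move=> yp; rewrite addrAC (le_lt_trans (ler_normD _ _))//; lra.
have fw : f (x + w) = 0.
  apply: f0; first exact: ball.
  move: xl; rewrite ltr_pdivlMr ?dotp_bound_gt0// mulrC => /(le_lt_trans (normr_dotp _ _)).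
  by rewrite dotpBr dotpDr ltr_norml => /andP[+ _]; lra.
suff : f (x + w) - f x = 0 by rewrite fw sub0r => /eqP; rewrite oppr_eq0 => /eqP.
apply: (He1 (fun x => f (x + w) - f x)) => //.
  apply: split_inv_ext (split_inv_shift we fg) => y yp.
  by rewrite (gv y)//; [ring|have := normr_ge0 (y - p); lra].
move=> y yp ly; rewrite !f0 ?subrr//.
- by have := normr_ge0 (y - p); lra.
- exact: ball.
- by rewrite dotpDr; lra.
Qed.

Definition tame l p f := exists vs e,
  [/\ 0 < e, {in vs, forall v, dotp l v != 0} & split_inv p e vs f].

Lemma tame_ext l p e f g : 0 < e -> (forall x, `|x - p| < e -> f x = g x) ->
  tame l p f -> tame l p g.
Proof.
move=> e0 fg [vs [e' [e'0 lvs fs]]]; exists vs, (Num.min e e'); split => //.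
  by rewrite lt_min e0.
apply: (@split_inv_ext _ _ _ f) => [x|]; first by rewrite lt_min => /andP[+ _]; exact: fg.
by apply: split_inv_le fs; rewrite ge_min lexx orbT.
Qed.

Lemma tame0 l p : tame l p (fun=> 0).
Proof. by exists [::], 1; split. Qed.

Lemma tameD l p f g : tame l p f -> tame l p g -> tame l p (fun x => f x + g x).
Proof.
move=> [vs [e [e0 lvs fs]]] [ws [e' [e'0 lws gs]]].
exists (vs ++ ws), (Num.min e e'); split; first by rewrite lt_min e0.
  by move=> v; rewrite mem_cat => /orP[/lvs|/lws].
by apply: split_invD; [apply: split_inv_le fs|apply: split_inv_le gs];
  rewrite ge_min lexx ?orbT.
Qed.

Lemma tameN l p f : tame l p f -> tame l p (fun x => - f x).
Proof. by move=> [vs [e [e0 lvs fs]]]; exists vs, e; split => //; exact: split_invN. Qed.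

Lemma tame_sum l p (I : eqType) (r : seq I) (F : I -> E -> R) :
  {in r, forall i, tame l p (F i)} -> tame l p (fun x => \sum_(i <- r) F i x).
Proof.
elim: r => [|i r IH] h.
  apply: (@tame_ext _ _ 1 (fun=> 0)) (tame0 _ _) => // x _; by rewrite big_nil.
apply: (@tame_ext _ _ 1 (fun x => F i x + \sum_(i <- r) F i x)) => // [x _|].
  by rewrite big_cons.
apply: tameD; first by apply: h; rewrite mem_head.
by apply: IH => j jr; apply: h; rewrite inE jr orbT.
Qed.

Lemma tame_loc_inv l p e v f : 0 < e -> dotp l v != 0 -> loc_inv p e v f ->
  tame l p f.
Proof.
move=> e0 lv fv; exists [:: v], e; split => //.
  by move=> v'; rewrite inE => /eqP ->.
by exists f => // x _; rewrite subrr.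
Qed.

(** A nonzero [f] would have a highest point in the closure of its support, where
    tameness forces it to vanish. *)
Lemma tame_vanishing l f : (forall p, tame l p f) ->
  (forall c, exists K, forall x, f x != 0 -> c <= dotp l x -> `|x| <= K) ->
  forall x, f x = 0.
Proof.
move=> ft fb x0; apply/eqP/negP => /negP fx0.
pose A := [set x | f x != 0 /\ dotp l x0 <= dotp l x].
have [K hK] := fb (dotp l x0).
have cA : compact (closure A).
  apply: bounded_closed_compact; last exact: closed_closure.
  exists (K + 1); split; [exact: num_real|move=> M KM y yA].
  have [z [[fz lz]]] := yA _ (nbhsx_ballx y 1 ltr01).
  rewrite -ball_normE/= => yz; have := hK z fz lz.
  by have := ler_normD (y - z) z; rewrite subrK; lra.
have A0 : closure A !=set0 by exists x0; apply: subset_closure; split.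
have Ac : {within closure A, continuous (dotp l : E -> R)}.
  by apply: continuous_subspaceT; exact: continuous_dotp.
have [p pA pmax] := compact_EVT_max A0 cA Ac.
have [vs [e [e0 lvs fs]]] := ft p.
have [e' e'0 He'] := local_vanishing p e0 lvs.
have lp : dotp l x0 <= dotp l p by apply: pmax; rewrite inE; apply: subset_closure; split.
have f0 := He' _ fs.
have : closure A p by rewrite inE in pA.
move=> /(_ (ball p e') (nbhsx_ballx _ _ e'0))[y [[fy ly]]].
rewrite -ball_normE/= distrC => yp.
move/eqP: fy; apply; apply: f0 => // x xp lx; apply/eqP/negP => /negP fx.
suff : dotp l x <= dotp l p by rewrite leNgt lx.
apply: pmax; rewrite inE; apply: subset_closure; split => //.
exact: le_trans lp (ltW lx).
Qed.

End LocalVanishing.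

(** * Half-open and flipped cones *)
Section Flip.
Variables (R : realType) (d : nat).
Local Notation E := 'rV[R]_d.
Implicit Types (l p x v w s : E) (u : 'M[R]_d).

(** Positivity of [t + e * tau] for all small [e > 0]. *)
Definition hpos (t tau : R) : bool := (0 < t) || ((t == 0) && (0 < tau)).

Lemma hpos_near t tau : hpos t tau -> \forall e \near 0^'+, 0 < t + e * tau.
Proof.
have tau1 : 0 < 1 + `|tau| by rewrite ltr_wpDr.
move=> /orP[t0|/andP[/eqP -> tau0]]; near=> e.
  have e0 : 0 < e by near: e; exact: nbhs_right_gt.
  have : e < t / (1 + `|tau|) by near: e; apply: nbhs_right_lt; rewrite divr_gt0.
  rewrite ltr_pdivlMr// mulrDr mulr1.
  have : - (e * `|tau|) <= e * tau by rewrite -mulrN ler_wpM2l ?(ltW e0)// lerNl ler_normr lexx orbT.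
  lra.
by rewrite add0r mulr_gt0//; near: e; exact: nbhs_right_gt.
Unshelve. all: by end_near. Qed.

Lemma hposN t tau : tau != 0 -> hpos (- t) (- tau) = ~~ hpos t tau.
Proof. by rewrite /hpos !oppr_gt0 oppr_eq0; case: (ltgtP t 0); case: (ltgtP tau 0). Qed.

Lemma hposN_near t tau : tau != 0 -> ~~ hpos t tau ->
  \forall e \near 0^'+, t + e * tau < 0.
Proof.
move=> tau0; rewrite -hposN// => /hpos_near; apply: filterS => e.
by rewrite mulrN -opprD oppr_gt0.
Qed.

Lemma hposE t tau : t != 0 -> hpos t tau = (0 < t).
Proof. by rewrite /hpos => /negbTE ->; rewrite orbF. Qed.

(** For a generic direction [w] this makes half-open versions of closed polyhedral
    sets, which do not overlap when only the boundaries of these sets do. *)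
Definition inw w (S : set E) x : Prop := \forall e \near 0^'+, S (x + e *: w).

Definition frame_cone u : set E := [set x | forall i, 0 <= (x *m invmx u) 0 i].
Definition frame_open u : set E := [set x | forall i, 0 < (x *m invmx u) 0 i].

Definition generic_frame w u := forall i, (w *m invmx u) 0 i != 0.

Definition half_cone w s u : pred E := fun x =>
  [forall i, hpos (cone_coord s u x 0 i) ((w *m invmx u) 0 i)].

Lemma cone_coord_shift w s u x e i :
  ((x + e *: w - s) *m invmx u) 0 i =
  cone_coord s u x 0 i + e * (w *m invmx u) 0 i.
Proof. by rewrite addrAC mulmxDl -scalemxAl !mxE. Qed.

Lemma half_cone_near w s u x : half_cone w s u x ->
  \forall e \near 0^'+, frame_open u (x + e *: w - s).
Proof.
move=> /forallP h; rewrite /frame_open /=.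
have : \forall e \near 0^'+, forall i : 'I_d, 0 < cone_coord s u x 0 i + e * (w *m invmx u) 0 i.
  by apply: filter_forall => i; exact/hpos_near/h.
by apply: filterS => e + i => /(_ i); rewrite cone_coord_shift.
Qed.

Lemma half_coneN_near w s u x : generic_frame w u -> ~~ half_cone w s u x ->
  \forall e \near 0^'+, ~ frame_cone u (x + e *: w - s).
Proof.
move=> gw; rewrite negb_forall => /existsP[i] /(hposN_near (gw i)).
by apply: filterS => e h /(_ i); rewrite cone_coord_shift leNgt h.
Qed.

(** The indicator of the half-line of positive [t], or minus that of the
    complementary half-line: in both cases the half-line where [c * t] is negative,
    up to boundary. *)
Definition flip_fun (c tau t : R) : R := (hpos t tau)%:R - (0 < c)%R%:R.

Definition flip_weight w l s u x : R :=
  \prod_i flip_fun (dotp l (row i u)) ((w *m invmx u) 0 i) (cone_coord s u x 0 i).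

Lemma half_coneE w s u x : (half_cone w s u x)%:R =
  \prod_i (hpos (cone_coord s u x 0 i) ((w *m invmx u) 0 i))%:R :> R.
Proof.
rewrite /half_cone; case: forallP => [h|/forallP]; first by rewrite big1// => i _; rewrite h.
by rewrite negb_forall => /existsP[i /negbTE hi]; rewrite (bigD1 i)//= hi mul0r.
Qed.

Lemma cone_coord_row s u x h i j : u \in unitmx ->
  cone_coord s u (x + h *: row i u) 0 j = cone_coord s u x 0 j + h *+ (i == j).
Proof.
move=> uu; rewrite /cone_coord addrAC mulmxDl -scalemxAl -row_mul mulmxV//.
by rewrite row1 !mxE eqxx/= [j == i]eq_sym mulr_natr.
Qed.

(** The two products agree up to a telescoping sum: exchanging one more factor
    changes the product by a term in which this factor has become constant, so that
    it is invariant along the corresponding generator. *)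
Lemma half_cone_flip_tame w l s u p : u \in unitmx ->
  (forall i, dotp l (row i u) != 0) ->
  tame l p (fun x => (half_cone w s u x)%:R - flip_weight w l s u x).
Proof.
move=> uu lu.
pose a (i : 'I_d) x : R := (hpos (cone_coord s u x 0 i) ((w *m invmx u) 0 i))%:R.
pose b (i : 'I_d) x : R :=
  flip_fun (dotp l (row i u)) ((w *m invmx u) 0 i) (cone_coord s u x 0 i).
(* the product in which the first [k] factors are flipped *)
pose mix k x := \prod_(i < d) (if (i < k)%N then b i x else a i x).
have step k : (k <= d)%N -> tame l p (fun x => mix 0%N x - mix k x).
  elim: k => [|k IH] kd.
    by apply: (@tame_ext _ _ _ _ 1 (fun=> 0)) (tame0 _ _) => // x _; rewrite subrr.
  pose i0 := Ordinal kd.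
  apply: (@tame_ext _ _ _ _ 1 (fun x => (mix 0%N x - mix k x) + (mix k x - mix k.+1 x))) => //.
    by move=> x _; ring.
  apply: tameD; first exact/IH/ltnW.
  apply: (@tame_loc_inv _ _ _ _ 1 (row i0 u)) => // x h _ _.
  have E y : mix k y - mix k.+1 y = (0 < dotp l (row i0 u))%R%:R *
      \prod_(i < d | i != i0) (if (i < k)%N then b i y else a i y).
    rewrite /mix (bigD1 i0)//= ltnn [X in _ - X](bigD1 i0)//= ltnSn.
    rewrite [X in _ - _ * X](eq_bigr (fun i : 'I_d => if (i < k)%N then b i y else a i y)).
      by rewrite /a /b /flip_fun; ring.
    move=> i; rewrite -val_eqE/= => ik.
    by rewrite ltnS leq_eqVlt (negbTE ik).
  rewrite !E; congr (_ * _); apply: eq_bigr => i ii0.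
  by rewrite /a /b cone_coord_row// eq_sym (negbTE ii0) addr0.
apply: (@tame_ext _ _ _ _ 1 _ _ _ _ (step d (leqnn d))) => // x _.
rewrite /mix half_coneE; congr (_ - _).
by apply: eq_bigr => i _; rewrite ltn_ord.
Qed.

Lemma coord_bounded s u : exists2 K, 0 < K &
  forall x y i, `|cone_coord s u x 0 i - cone_coord s u y 0 i| <= K * `|x - y|.
Proof.
pose K := \sum_i dotp_bound (col i (invmx u))^T.
exists (1 + K).
  by rewrite ltr_wpDr// sumr_ge0// => i _; exact/ltW/dotp_bound_gt0.
move=> x y i.
have -> : cone_coord s u x 0 i - cone_coord s u y 0 i = dotp (col i (invmx u))^T (x - y).
  have -> : cone_coord s u x 0 i - cone_coord s u y 0 i =
            (cone_coord s u x - cone_coord s u y) 0 i by rewrite !mxE.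
  rewrite /cone_coord -mulmxBl opprB addrA subrK mxE.
  by apply: eq_bigr => j _; rewrite !mxE mulrC.
apply: (le_trans (normr_dotp _ _)); rewrite ler_wpM2r//.
rewrite /K (bigD1 i)//= addrCA lerDl addr_ge0// sumr_ge0// => j _.
exact/ltW/dotp_bound_gt0.
Qed.

(** Some coordinate of [p] is nonzero and keeps its sign nearby, so that moving along
    the generator of this coordinate changes no factor. *)
Lemma flip_weight_tame w l s u p : u \in unitmx ->
  (forall i, dotp l (row i u) != 0) -> p != s -> tame l p (flip_weight w l s u).
Proof.
move=> uu lu ps.
have [i ti] : exists i, cone_coord s u p 0 i != 0.
  apply/existsP; rewrite -negb_forall; apply: contra ps => /forallP h.
  rewrite (cone_coordK s p uu) (_ : cone_coord s u p = 0) ?mul0mx ?addr0//.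
  by apply/rowP => i; rewrite [RHS]mxE; apply/eqP/h.
have [K K0 hK] := coord_bounded s u.
pose t := cone_coord s u p 0 i.
have t0 : 0 < `|t| by rewrite normr_gt0.
have e1 : 0 < `|t| / 2 by rewrite divr_gt0.
pose e := Num.min (`|t| / 2) (`|t| / 2 / K).
have hsgn y : `|y - t| < `|t| -> (hpos y ((w *m invmx u) 0 i)) = (0 < t).
  move=> yt; have y0 : y != 0.
    by apply: contraTneq yt => ->; rewrite sub0r normrN ltxx.
  rewrite hposE//; move: yt; rewrite ltr_norml => /andP[].
  case: (ltrgtP t 0) => [tn|tp|tt]; last by rewrite tt normr0 in t0; rewrite ltxx in t0.
    by rewrite ltr0_norm// => *; apply/negbTE; rewrite -leNgt; lra.
  by rewrite gtr0_norm// => *; lra.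
apply: (@tame_loc_inv _ _ _ _ e (row i u)) => //.
  by rewrite lt_min e1 divr_gt0.
move=> x h; rewrite !lt_min => /andP[_ xp] /andP[hp _].
have xt : `|cone_coord s u x 0 i - t| < `|t| / 2.
  apply: le_lt_trans (hK _ _ _) _.
  by move: xp; rewrite ltr_pdivlMr// mulrC.
apply: eq_bigr => j _; rewrite cone_coord_row//; case: eqVneq => [<-|_]; last by rewrite addr0.
rewrite /flip_fun !hsgn//; first lra.
by rewrite mulr1n addrAC (le_lt_trans (ler_normD _ _))//; lra.
Qed.

End Flip.

(** * The flip identity for a polyhedron *)
Section FlipIdentity.
Variables (R : realType) (d m : nat).
Local Notation E := 'rV[R]_d.
Variables (A : 'I_m -> E) (b : 'I_m -> R).
Implicit Types (l p x v w s : E) (u : 'M[R]_d).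

Definition Hpoly : set E := [set x | forall j, dotp (A j) x <= b j].

Definition active p : pred 'I_m := fun j => dotp (A j) p == b j.

Lemma near_active p : Hpoly p -> exists2 e, 0 < e & forall x, `|x - p| < e ->
  forall j, ~~ active p j -> dotp (A j) x < b j.
Proof.
move=> Pp.
have : \forall x \near p, forall j, ~~ active p j -> dotp (A j) x < b j.
  apply: (@filter_forall _ _ (fun j x => ~~ active p j -> dotp (A j) x < b j) (nbhs p)) => j; have [pj|pj] := boolP (active p j).
    by apply: nearW => x.
  have pj' : dotp (A j) p < b j by rewrite lt_neqAle pj Pp.
  by apply: filterS (cvgr_lt _ (@continuous_dotp R d (A j) p) _ pj') => x xb _.
move=> /nbhs_ballP[e e0 He]; exists e => // x xp; apply: He.
by rewrite -ball_normE/= distrC.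
Qed.

Lemma local_active p : Hpoly p -> exists2 e, 0 < e & forall x, `|x - p| < e ->
  Hpoly x <-> forall j, active p j -> dotp (A j) (x - p) <= 0.
Proof.
move=> Pp; have [e e0 He] := near_active Pp; exists e => // x xp; split=> [Px j /eqP pj|h j].
  by rewrite dotpBr pj subr_le0.
have [pj|pj] := boolP (active p j); last exact/ltW/He.
by have := h j pj; rewrite dotpBr (eqP pj) subr_le0.
Qed.

(** The feasible directions are cut out by the active constraints alone: the other
    ones are strict at [p] and allow a small step in any direction. *)
Lemma feasible_active p y : Hpoly p ->
  feasible_cone Hpoly p y <-> forall j, active p j -> dotp (A j) y <= 0.
Proof.
move=> Pp; split=> [[e e0 Pe] j /eqP pj|h].
  have := Pe j; rewrite dotpDr pj dotpZr gerDl pmulr_rle0//.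
have [e e0 He] := local_active Pp.
have [c c0 cy] := exists_small_scale y e0.
exists c => //; apply/He; first by rewrite addrC addKr.
by move=> j pj; rewrite addrC addKr dotpZr pmulr_rle0//; exact: h.
Qed.

Lemma local_feasible p : Hpoly p -> exists2 e, 0 < e & forall x, `|x - p| < e ->
  Hpoly x <-> feasible_cone Hpoly p (x - p).
Proof.
move=> Pp; have [e e0 He] := local_active Pp; exists e => // x xp.
by rewrite He// feasible_active.
Qed.

Lemma Hpoly_compl_near p : ~ Hpoly p -> exists2 e, 0 < e & forall x, `|x - p| < e -> ~ Hpoly x.
Proof.
move=> /existsNP[j /negP]; rewrite -ltNge => pj.
have : \forall x \near p, b j < dotp (A j) x.
  exact: (cvgr_gt _ (@continuous_dotp R d (A j) p) _ pj).
move=> /nbhs_ballP[e e0 He]; exists e => // x xp Px.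
have := Px j; rewrite leNgt; move/negP; apply; apply: He.
by rewrite -ball_normE/= distrC.
Qed.

Lemma at_right_ex2 (F G : set R) : (\forall e \near 0^'+, F e) ->
  (\forall e \near 0^'+, G e) -> exists e, F e /\ G e.
Proof.
move=> hF hG; have hFG : \forall e \near (0 : R)^'+, F e /\ G e by exact: filterI.
exact: (@filter_ex _ _ (at_right_proper_filter (0 : R)) _ hFG).
Qed.

Lemma at_right_seq (I : eqType) (r : seq I) (F : I -> set R) :
  (forall i, i \in r -> \forall e \near 0^'+, F i e) ->
  \forall e \near 0^'+, forall i, i \in r -> F i e.
Proof.
elim: r => [_|i r IH h]; first by apply: nearW.
have h1 := h i (mem_head _ _).
have h2 : \forall e \near 0^'+, forall i, i \in r -> F i e.
  by apply: IH => j jr; apply: h; rewrite inE jr orbT.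
by apply: filterS2 h1 h2 => e k1 k2 j; rewrite inE => /predU1P[->//|/k2].
Qed.

Lemma ball_shift_near w p x (e : R) : `|x - p| < e ->
  \forall h \near 0^'+, `|x + h *: w - p| < e.
Proof.
move=> xp; near=> h.
have h0 : 0 < h by near: h; exact: nbhs_right_gt.
have w1 : 0 < 1 + `|w| by rewrite ltr_wpDr.
have : h < (e - `|x - p|) / (1 + `|w|).
  by near: h; apply: nbhs_right_lt; rewrite divr_gt0// subr_gt0.
rewrite ltr_pdivlMr// addrAC => hh.
rewrite (le_lt_trans (ler_normD _ _))// normrZ gtr0_norm//; lra.
Unshelve. all: by end_near. Qed.

Lemma inw_sub w x : inw w Hpoly x -> Hpoly x.
Proof.
move=> Px; apply: contrapT => /Hpoly_compl_near[e e0 He].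
have xx : `|x - x| < e by rewrite subrr normr0.
have [h [h1 h2]] := at_right_ex2 Px (ball_shift_near w xx).
exact: He h2 h1.
Qed.

Lemma outside_tame w l p : ~ Hpoly p -> tame l p (fun x => `[< inw w Hpoly x >]%:R).
Proof.
move=> /Hpoly_compl_near[e e0 He].
apply: (@tame_ext _ _ _ _ e (fun=> 0)) (tame0 _ _) => // x xp.
by case: asboolP => // /inw_sub /(He _ xp).
Qed.

(** The active constraints do not see [v] and the other ones stay strict near [p], so
    that a displacement along [v] does not change membership. *)
Lemma nonvertex_tame w l p v : Hpoly p -> dotp l v != 0 ->
  (forall j, active p j -> dotp (A j) v = 0) ->
  tame l p (fun x => `[< inw w Hpoly x >]%:R).
Proof.
move=> Pp lv Av; have [e e0 He] := local_active Pp.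
have v1 : 0 < 1 + `|v| by rewrite ltr_wpDr.
have e2 : 0 < e / 2 by rewrite divr_gt0.
apply: (@tame_loc_inv _ _ _ _ (Num.min (e / 2) (e / 2 / (1 + `|v|))) v) => //.
  by rewrite lt_min e2 divr_gt0.
move=> x h; rewrite !lt_min => /andP[xp _] /andP[_ hv].
have hv2 : `|h *: v| < e / 2.
  move: hv; rewrite ltr_pdivlMr// => hv; rewrite normrZ; have := normr_ge0 h; lra.
congr ((nat_of_bool _)%:R); apply: asbool_equiv_eq.
have xe : `|x - p| < e by lra.
have xhe : `|x + h *: v - p| < e.
  by rewrite addrAC (le_lt_trans (ler_normD _ _))//; lra.
have n1 := ball_shift_near w xe; have n2 := ball_shift_near w xhe.
have key k : `|x + k *: w - p| < e -> `|x + h *: v + k *: w - p| < e ->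
    Hpoly (x + h *: v + k *: w) <-> Hpoly (x + k *: w).
  move=> b1 b2; rewrite !He//.
  have E j : active p j ->
      dotp (A j) (x + h *: v + k *: w - p) = dotp (A j) (x + k *: w - p).
    by move=> /Av vj; rewrite !(dotpBr, dotpDr) [dotp _ (h *: v)]dotpZr vj mulr0 addr0.
  by split=> H j pj; have := H j pj; rewrite E.
split=> Px; apply: filterS3 n1 n2 Px => k b1 b2; by have [] := key k b1 b2.
Qed.

(** What the flip identity retains of a triangulation of [K]: the overlaps of its
    cones avoid the interiors. *)
Definition frame_cover (K : set E) (D : seq 'M[R]_d) := [/\ uniq D,
  {in D, forall u, u \in unitmx},
  (forall x, K x <-> exists2 u, u \in D & frame_cone u x) &
  forall u v : 'M[R]_d, u \in D -> v \in D ->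
    forall x, frame_open u x -> frame_cone v x -> u = v].

(** Displaced in the direction [w], a point near [p] lies off the boundaries of the
    cones, hence in exactly one of them if it lies in the polyhedron. *)
Lemma half_cone_cover w p D x e : Hpoly p -> frame_cover (feasible_cone Hpoly p) D ->
  {in D, forall u, generic_frame w u} ->
  (forall x, `|x - p| < e -> Hpoly x <-> feasible_cone Hpoly p (x - p)) ->
  `|x - p| < e ->
  `[< inw w Hpoly x >]%:R = \sum_(u <- D) (half_cone w p u x)%:R :> R.
Proof.
move=> Pp [uD unitD covD disD] gD He xp.
have nx := ball_shift_near w xp.
have [/hasP[u uinD hu]|/hasPn hN] := boolP (has (fun u => half_cone w p u x) D).
  rewrite (bigD1_seq u)//= hu big_seq_cond big1 => [|v /andP[vD vu]].
    rewrite addr0; case: asboolP => // /(_ _)[].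
    apply: filterS2 nx (half_cone_near hu) => h /He -> hh.
    by apply/covD; exists u => // i; exact/ltW/hh.
  apply/eqP; rewrite pnatr_eq0 eqb0; apply: contra vu => hv; apply/eqP.
  have [h [h1 h2]] := at_right_ex2 (half_cone_near hu) (half_cone_near hv).
  by apply/esym; apply: (disD u v uinD vD _ h1) => i; exact/ltW/h2.
rewrite big_seq_cond big1 => [|u /andP[/hN/negbTE ->]//].
case: asboolP => // Px.
have nN : \forall h \near 0^'+, forall u, u \in D -> ~ frame_cone u (x + h *: w - p).
  by apply: at_right_seq => u uinD; apply: half_coneN_near; [exact: gD|exact: hN].
have nP : \forall h \near 0^'+, feasible_cone Hpoly p (x + h *: w - p).
  by apply: filterS2 nx Px => h /He -> .
have [h [h2 /covD[u uinD]]] := at_right_ex2 nN nP.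
by move=> /(h2 _ uinD).
Qed.

Definition height_bounded l (f : E -> R) :=
  forall c, exists K, forall x, f x != 0 -> c <= dotp l x -> `|x| <= K.

Lemma height_boundedB l f g : height_bounded l f -> height_bounded l g ->
  height_bounded l (fun x => f x - g x).
Proof.
move=> hf hg c; have [K hK] := hf c; have [K' hK'] := hg c.
exists (Num.max K K') => x fg cx; rewrite le_max.
have [fx|fx] := eqVneq (f x) 0; last by rewrite hK.
by rewrite hK' ?orbT//; move: fg; rewrite fx sub0r oppr_eq0.
Qed.

Lemma height_bounded_sum l (I : eqType) (r : seq I) (F : I -> E -> R) :
  {in r, forall i, height_bounded l (F i)} ->
  height_bounded l (fun x => \sum_(i <- r) F i x).
Proof.
elim: r => [|i r IH] h.
  by move=> c; exists 0 => x; rewrite big_nil eqxx.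
have -> : (fun x => \sum_(j <- i :: r) F j x) = fun x => F i x - - \sum_(j <- r) F j x.
  by apply/funext => x; rewrite big_cons opprK.
apply: height_boundedB; first by apply: h; rewrite mem_head.
move=> c; have [|K hK] := IH _ c.
  by move=> j jr; apply: h; rewrite inE jr orbT.
by exists K => x; rewrite oppr_eq0; exact: hK.
Qed.

Lemma flip_fun_neq0 (c tau t : R) : c != 0 -> flip_fun c tau t != 0 -> c * t <= 0.
Proof.
move=> c0; rewrite /flip_fun /hpos; case: (ltrgtP c 0) c0 => // c0 _.
  rewrite subr0; case: (ltrgtP t 0) => t0; rewrite ?eqxx//=; last by rewrite t0 mulr0.
  by move=> _; rewrite ltW// nmulr_rlt0.
case: (ltrgtP t 0) => t0; rewrite ?subrr ?eqxx//=; last by rewrite t0 mulr0.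
by move=> _; rewrite ltW// pmulr_rlt0.
Qed.

Lemma flip_weight_bounded w l s u : u \in unitmx ->
  (forall i, dotp l (row i u) != 0) -> height_bounded l (flip_weight w l s u).
Proof.
move=> uu lu c.
pose B i := (dotp l s - c) / `|dotp l (row i u)|.
exists (`|s| + \sum_i B i * `|row i u|) => x /prodf_neq0 fx cx.
have tx i : dotp l (row i u) * cone_coord s u x 0 i <= 0.
  by apply: flip_fun_neq0 (lu i) (fx i isT).
have lx : dotp l x = dotp l s + \sum_i dotp l (row i u) * cone_coord s u x 0 i.
  rewrite {1}(cone_coordK s x uu) dotpDr dotp_mulmx; congr (_ + _).
  by apply: eq_bigr => i _; rewrite mulrC.
rewrite {1}(cone_coordK s x uu) (le_trans (ler_normD _ _))// lerD2l.
rewrite mulmx_sum_row (le_trans (ler_norm_sum _ _ _))// ler_sum// => i _.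
rewrite normrZ ler_wpM2r// /B ler_pdivlMr ?normr_gt0// -normrM mulrC ler0_norm//.
move: cx; rewrite lx (bigD1 i)//=.
have : \sum_(j < d | j != i) dotp l (row j u) * cone_coord s u x 0 j <= 0.
  by apply: sumr_le0 => j _.
lra.
Qed.

(** The decomposition of Lawrence and Varchenko, half-open so that it holds at every
    point. The list [S] stands for the vertices: every other point of the polyhedron
    lies on a line along which its active constraints are constant and [l] is not. *)
Theorem flip_identity l w (S : seq E) (D : E -> seq 'M[R]_d) :
  uniq S -> {in S, forall s, Hpoly s} ->
  {in S, forall s, frame_cover (feasible_cone Hpoly s) (D s)} ->
  {in S, forall s, {in D s, forall u, generic_frame w u}} ->
  {in S, forall s, {in D s, forall u i, dotp l (row i u) != 0}} ->
  (forall p, Hpoly p -> p \notin S -> exists2 v, dotp l v != 0 &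
    forall j, active p j -> dotp (A j) v = 0) ->
  (exists K, forall x, Hpoly x -> `|x| <= K) ->
  forall x, `[< inw w Hpoly x >]%:R =
    \sum_(s <- S) \sum_(u <- D s) flip_weight w l s u x.
Proof.
move=> uS PS covS gS lS nvS [K hK] x; apply/eqP; rewrite -subr_eq0; apply/eqP; move: x.
have tflip p s u : s \in S -> u \in D s -> p != s -> tame l p (flip_weight w l s u).
  move=> sS us ps; have [_ unitD _ _] := covS _ sS.
  by apply: flip_weight_tame => //; [exact: unitD|exact: (lS _ sS _ us)].
apply: (@tame_vanishing _ _ l) => [p|]; last first.
  apply: height_boundedB; last first.
    apply: height_bounded_sum => s sS; apply: height_bounded_sum => u us.
    have [_ unitD _ _] := covS _ sS.
    by apply: flip_weight_bounded; [exact: unitD|exact: (lS _ sS _ us)].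
  by move=> c; exists K => x; case: asboolP => [/inw_sub/hK //|]; rewrite eqxx.
have [pS|pS] := boolP (p \in S); last first.
  apply: tameD.
    have [Pp|] := pselect (Hpoly p); last exact: outside_tame.
    have [v lv Av] := nvS _ Pp pS; exact: nonvertex_tame lv Av.
  apply: tameN; apply: tame_sum => s sS; apply: tame_sum => u us; apply: tflip => //.
  by apply: contraNneq pS => ->.
have [e e0 He] := local_feasible (PS _ pS).
have [_ unitD _ _] := covS _ pS.
apply: (@tame_ext _ _ _ _ e (fun x =>
   \sum_(u <- D p) ((half_cone w p u x)%:R - flip_weight w l p u x) +
   - \sum_(s <- S | s != p) \sum_(u <- D s) flip_weight w l s u x)) => //.
  move=> x xp; rewrite (half_cone_cover (PS _ pS) (covS _ pS) (gS _ pS) He xp).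
  by rewrite [in RHS](bigD1_seq p)//= opprD addrA -sumrB.
apply: tameD.
  apply: tame_sum => u us; apply: half_cone_flip_tame; [exact: unitD|exact: (lS _ pS _ us)].
apply: tameN.
apply: (@tame_ext _ _ _ _ 1 (fun x => \sum_(s <- [seq s <- S | s != p]) \sum_(u <- D s) flip_weight w l s u x)) => //.
  by move=> x _; rewrite big_filter.
apply: tame_sum => s; rewrite mem_filter => /andP[sp sS].
by apply: tame_sum => u us; apply: tflip => //; rewrite eq_sym.
Qed.

End FlipIdentity.

(** * Laurent expansions *)
Section Laurent.
Variable R : realType.
Implicit Types (f g : R -> R) (a c : R^nat) (t x : R).

Definition pterm a t : R^nat := fun j => a j * t ^+ j.

Lemma cvg_pterm_bounded a t (y : R) : series (pterm a t) @ \oo --> y ->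
  exists K, forall j, `|a j * t ^+ j| <= K.
Proof.
move=> h; have : cvgn (pterm a t).
  apply/cvg_ex; exists 0; apply: cvg_series_cvg_0; apply/cvg_ex; by exists y.
move/cvg_seq_bounded => [K [_ hK]]; exists (K + 1) => j.
by apply: hK => //; lra.
Qed.

(** Identity principle: if the coefficients below [n] vanish, dividing by [t ^+ n]
    and letting [t] tend to [0] shows that so does the [n]-th. *)
Lemma pseries_eq0 a : (\forall t \near 0^', series (pterm a t) @ \oo --> (0 : R)) ->
  forall n, a n = 0.
Proof.
move=> /nbhs_ballP[e /= e0 He].
have He' t : t != 0 -> `|t| < e -> series (pterm a t) @ \oo --> (0 : R).
  by move=> t0 te; apply: He => //; rewrite -ball_normE/= sub0r normrN.
pose t0 := e / 2.
have t00 : 0 < t0 by rewrite divr_gt0.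
have [K hK] : exists K, forall j, `|a j * t0 ^+ j| <= K.
  by apply: (@cvg_pterm_bounded _ _ 0); apply: He'; rewrite ?gt_eqF// gtr0_norm// /t0; lra.
have K0 : 0 <= K by apply: le_trans (hK 0%N).
apply: ltn_ind => n IH; apply/eqP; rewrite -normr_le0; apply/ler_addgt0Pr => eps eps0.
rewrite add0r.
pose r := Num.min (1 / 2) (eps * t0 ^+ n / (2 * (1 + K))).
have K1 : 0 < 2 * (1 + K) by rewrite mulr_gt0// ltr_wpDr.
have r0 : 0 < r by rewrite lt_min divr_gt0//= divr_gt0// mulr_gt0// exprn_gt0.
have r12 : r <= 1 / 2 by rewrite ge_min lexx.
pose t := r * t0.
have tn0 : t != 0 by rewrite mulf_neq0// gt_eqF.
have te : `|t| < e.
  rewrite gtr0_norm ?mulr_gt0//; apply: (@le_lt_trans _ _ (1 / 2 * t0)); first by rewrite ler_wpM2r// ltW.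
  by rewrite /t0; lra.
have tail m : `|series (pterm a t) (n.+1 + m)%N - a n * t ^+ n| <= K * r ^+ n.+1 * 2.
  have E : series (pterm a t) (n.+1 + m)%N - a n * t ^+ n = \sum_(n.+1 <= j < (n.+1 + m)%N) a j * t ^+ j.
    rewrite /series/= (@big_cat_nat _ _ _ n.+1)//=; last exact: leq_addr.
    rewrite big_nat_recr//= big_nat big1 ?add0r; last by move=> i /IH; rewrite /pterm => ->; rewrite mul0r.
    by rewrite /pterm addrAC subrr add0r.
  rewrite {}E (le_trans (ler_norm_sum _ _ _))//.
  apply: (@le_trans _ _ (\sum_(n.+1 <= j < (n.+1 + m)%N) K * r ^+ j)).
    apply: ler_sum => j _; rewrite /t exprMn mulrCA normrM mulrC.
    by rewrite (ger0_norm (exprn_ge0 _ (ltW r0))) ler_wpM2r// exprn_ge0// ltW.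
  rewrite -mulr_sumr -mulrA ler_wpM2l//.
  rewrite -{1}[n.+1]add0n big_addn addKn.
  under eq_bigr do rewrite addnC exprD.
  rewrite -mulr_sumr ler_wpM2l ?exprn_ge0 ?(ltW r0)//.
  elim: m => [|m IHm]; first by rewrite big_geq.
  rewrite big_nat_recl// expr0; under eq_bigr do rewrite exprS.
  rewrite -mulr_sumr.
  have : r * \sum_(0 <= i < m) r ^+ i <= 1 / 2 * 2 by apply: ler_pM => //; rewrite ?sumr_ge0 ?(ltW r0)// => *; rewrite exprn_ge0// ltW.
  lra.
have lim : `|0 - a n * t ^+ n| <= K * r ^+ n.+1 * 2.
  have h : (fun m => `|series (pterm a t) (n.+1 + m)%N - a n * t ^+ n|) @ \oo --> `|0 - a n * t ^+ n|.
    apply: cvg_norm; apply: cvgB; last exact: cvg_cst.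
    under eq_fun do rewrite addnC.
    by have := He' t tn0 te; rewrite -(cvg_shiftn n.+1).
  by apply: (ler_cvg_to h (cvg_cst _)); apply: nearW.
move: lim; rewrite sub0r normrN normrM /t exprMn [X in _ * X]normrM.
rewrite (ger0_norm (exprn_ge0 n (ltW r0))) (ger0_norm (exprn_ge0 n (ltW t00))).
rewrite mulrCA exprS => lim.
have rn0 : 0 < r ^+ n by rewrite exprn_gt0.
have tn : 0 < t0 ^+ n by rewrite exprn_gt0.
have lim2 : `|a n| * t0 ^+ n <= K * r * 2.
  by rewrite -(ler_pM2l rn0) (le_trans lim)// le_eqVlt; apply/orP; left; apply/eqP; ring.
have : r <= eps * t0 ^+ n / (2 * (1 + K)) by rewrite ge_min lexx orbT.
rewrite ler_pdivlMr// => hr.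
rewrite -(ler_pM2r tn) (le_trans lim2)// (le_trans _ hr)//.
rewrite mulrAC [leRHS]mulrC ler_pM2r//; lra.
Qed.

Implicit Types (z : int -> R) (N : nat).

Lemma eq_cvgn (u v : R^nat) (y : R) : u =1 v -> u @ \oo --> y -> v @ \oo --> y.
Proof. by move=> /funext ->. Qed.

Definition laurent_from N f z :=
  (forall k : int, k < - N%:Z -> z k = 0) /\
  \forall t \near 0^', series (fun j : nat =>
    z (j%:Z - N%:Z) * t ^ (j%:Z - N%:Z)) @ \oo --> f t.

Lemma exprz_subn t (j N : nat) : t != 0 -> t ^ (j%:Z - N%:Z) = t ^+ j / t ^+ N.
Proof. by move=> t0; rewrite expfzDr// exprnN. Qed.

Lemma laurent_fromP N f z : (forall k : int, k < - N%:Z -> z k = 0) ->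
  (\forall t \near 0^', series (pterm (fun j => z (j%:Z - N%:Z)) t) @ \oo --> t ^+ N * f t) <->
  laurent_from N f z.
Proof.
move=> zN.
have E t : t != 0 -> series (fun j : nat => z (j%:Z - N%:Z) * t ^ (j%:Z - N%:Z)) =
    (fun n => t ^- N * series (pterm (fun j => z (j%:Z - N%:Z)) t) n).
  move=> t0; apply/funext => n; rewrite /series/= mulr_sumr; apply: eq_bigr => j _.
  by rewrite exprz_subn// /pterm; ring.
split=> [h|[_ h]]; first split => //.
  have t0 : \forall t \near (0 : R)^', t != 0 by exact: nbhs_dnbhs_neq.
  apply: filterS2 t0 h => t t0 h; rewrite E// -[f t](mulKf (expf_neq0 N t0)).
  by apply: cvgM => //; exact: cvg_cst.
have t0 : \forall t \near (0 : R)^', t != 0 by exact: nbhs_dnbhs_neq.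
apply: filterS2 t0 h => t t0; rewrite E// => h.
rewrite [X in X @ _](_ : _ = fun n => t ^+ N * (t ^- N * series (pterm (fun j => z (j%:Z - N%:Z)) t) n)).
  by apply: cvgM => //; exact: cvg_cst.
by apply/funext => n; rewrite mulVKf// expf_neq0.
Qed.

(** Two expansions can be compared only when written with the same [N]. *)
Lemma laurent_from_le N N' f z : (N <= N')%N -> laurent_from N f z -> laurent_from N' f z.
Proof.
move=> NN' [zN h]; split.
  by move=> k kN'; apply: zN; apply: lt_le_trans kN' _; rewrite lerN2 lez_nat.
apply: filterS h => t h.
rewrite -(cvg_shiftn (N' - N)%N); apply: eq_cvgn h => n; apply/esym.
rewrite /series/= (@big_cat_nat _ _ _ (N' - N)%N 0 (n + _)%N)//= ?leq_addl//.
rewrite big_nat big1 ?add0r => [|i /andP[_ iN]]; last first.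
  by rewrite zN ?mul0r//; lia.
rewrite -{1}[(N' - N)%N]add0n big_addn addnK; apply: eq_bigr => i _.
by rewrite (_ : (i + (N' - N))%N%:Z - N'%:Z = i%:Z - N%:Z)//; lia.
Qed.

Lemma is_laurent_uniq f z z' : is_laurent f z -> is_laurent f z' -> z = z'.
Proof.
move=> [N h] [N' h'].
have [zN H] := laurent_from_le (leq_maxl N N') h.
have [zN' H'] := laurent_from_le (leq_maxr N N') h'.
set M := maxn N N' in zN H zN' H'.
have /(laurent_fromP _ zN) K : laurent_from M f z by split.
have /(laurent_fromP _ zN') K' : laurent_from M f z' by split.
have a0 := @pseries_eq0 (fun j => z (j%:Z - M%:Z) - z' (j%:Z - M%:Z)) _.
have {}a0 n : z (n%:Z - M%:Z) - z' (n%:Z - M%:Z) = 0.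
  apply: a0; apply: filterS2 K K' => t k k'.
  rewrite -(subrr (t ^+ M * f t)); apply: eq_cvgn (cvgB k k') => m.
  rewrite -[LHS]/(series _ m - series _ m) /series/= -sumrB; apply: eq_bigr => j _.
  by rewrite /pterm mulrBl.
apply/funext => k; have [kM|kM] := ltP k (- M%:Z); first by rewrite zN// zN'.
have := a0 (absz (k + M%:Z)); rewrite gez0_abs; last by rewrite -lerBlDr sub0r.
by rewrite addrK => /subr0_eq.
Qed.

Lemma laurent_coefE f z : is_laurent f z -> laurent_coef f = z.
Proof.
move=> fz; rewrite /laurent_coef; apply: (is_laurent_uniq _ fz).
exact: (xgetPex _ (ex_intro _ _ fz)).
Qed.

Lemma is_laurent_ext f g z : (\forall t \near 0^', f t = g t) ->
  is_laurent f z -> is_laurent g z.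
Proof.
move=> fg [N [zN h]]; exists N; split => //.
by apply: filterS2 fg h => t <-.
Qed.

Lemma is_laurentD f g z z' : is_laurent f z -> is_laurent g z' ->
  is_laurent (fun t => f t + g t) (fun k => z k + z' k).
Proof.
move=> [N h] [N' h']; exists (maxn N N').
have [zN H] := laurent_from_le (leq_maxl N N') h.
have [zN' H'] := laurent_from_le (leq_maxr N N') h'.
split=> [k kN|]; first by rewrite zN// zN'// addr0.
apply: filterS2 H H' => t hz hz'.
apply: eq_cvgn (cvgD hz hz') => n.
by rewrite -[LHS]/(series _ n + series _ n) /series/= -big_split; apply: eq_bigr => j _; rewrite /= mulrDl.
Qed.

Lemma is_laurentZ b f z : is_laurent f z ->
  is_laurent (fun t => b * f t) (fun k => b * z k).
Proof.
move=> [N [zN h]]; exists N; split=> [k kN|]; first by rewrite zN// mulr0.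
apply: filterS h => t h.
apply: eq_cvgn (cvgM (cvg_cst b) h) => n.
by rewrite -[LHS]/(b * series _ n) /series/= mulr_sumr; apply: eq_bigr => j _; rewrite mulrA.
Qed.

Lemma is_laurent0 : is_laurent (fun=> 0) (fun=> 0 : R).
Proof.
exists 0%N; split => //; apply: nearW => t.
rewrite (_ : series _ = cst 0); first exact: cvg_cst.
by apply/funext => n; rewrite /series/= big1// => j _; rewrite mul0r.
Qed.

Lemma is_laurent_sum (I : eqType) (r : seq I) (F : I -> R -> R) (Z : I -> int -> R) :
  {in r, forall i, is_laurent (F i) (Z i)} ->
  is_laurent (fun t => \sum_(i <- r) F i t) (fun k => \sum_(i <- r) Z i k).
Proof.
elim: r => [|i r IH] h.
  rewrite (_ : (fun t => _) = fun=> 0); last by apply/funext => t; rewrite big_nil.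
  rewrite (_ : (fun k => _) = fun=> 0); last by apply/funext => t; rewrite big_nil.
  exact: is_laurent0.
rewrite (_ : (fun t => _) = fun t => F i t + \sum_(i <- r) F i t); last first.
  by apply/funext => t; rewrite big_cons.
rewrite (_ : (fun k => _) = fun k => Z i k + \sum_(i <- r) Z i k); last first.
  by apply/funext => t; rewrite big_cons.
apply: is_laurentD; first exact: h (mem_head _ _).
by apply: IH => j jr; apply: h; rewrite inE jr orbT.
Qed.

Lemma is_laurent_divX f z : is_laurent f z ->
  is_laurent (fun t => f t / t) (fun k => z (k + 1)).
Proof.
move=> [N [zN h]]; exists N.+1; split=> [k kN|]; first by rewrite zN//; lia.
have t0 : \forall t \near (0 : R)^', t != 0 by exact: nbhs_dnbhs_neq.
apply: filterS2 t0 h => t t0 h.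
apply: eq_cvgn (cvgM h (cvg_cst t^-1)) => n.
rewrite -[LHS]/(series _ n * t^-1) /series/= mulr_suml; apply: eq_bigr => j _.
rewrite (_ : j%:Z - N.+1%:Z + 1 = j%:Z - N%:Z); last lia.
by rewrite !exprz_subn// -mulrA -mulrA exprSr invfM.
Qed.

(** Convergence alone does not pass through a division; it does together with a
    geometric bound on the coefficients. *)
Definition pow_exp f a :=
  (exists K q : R, [/\ 0 <= K, 0 <= q & forall j, `|a j| <= K * q ^+ j]) /\
  \forall t \near 0, series (pterm a t) @ \oo --> f t.

Lemma pow_exp_horner (p : {poly R}) : pow_exp (horner p) (fun j => p`_j).
Proof.
split.
  exists (\sum_(i < size p) `|p`_i|), 1; split => // [|j]; first exact: sumr_ge0.
  rewrite expr1n mulr1; have [jp|jp] := ltnP j (size p).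
    by rewrite (bigD1 (Ordinal jp))//= lerDl sumr_ge0.
  by rewrite nth_default// normr0 sumr_ge0.
apply: filterE => t; rewrite -(cvg_shiftn (size p)).
rewrite (_ : (fun n => _) = cst p.[t]); first exact: cvg_cst.
apply/funext => n; rewrite /series/= (@big_cat_nat _ _ _ (size p))//= ?leq_addl//.
rewrite [X in _ + X]big_nat [X in _ + X]big1 ?addr0 ?horner_coef ?big_mkord//.
by move=> i /andP[pi _]; rewrite /pterm nth_default// mul0r.
Qed.

Lemma nbhs_affine_neq0 (al be : R) : al != 0 -> \forall t \near (0 : R), al + be * t != 0.
Proof.
move=> al0; have : (fun t : R => al + be * t) @ (0 : R) --> al + be * 0.
  by apply: cvgD; [exact: cvg_cst|exact: mulrl_continuous].
rewrite mulr0 addr0 => /(_ [set y | y != 0]); apply.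
exact: (open_nbhs_nbhs (conj (@open_neq _ 0) al0)).
Qed.

Lemma pow_exp_div f a (al be : R) : al != 0 -> pow_exp f a ->
  exists a', pow_exp (fun t => f t / (al + be * t)) a'.
Proof.
move=> al0 [[K [q [K0 q0 hK]]] h].
pose ga := - be / al.
(* the coefficients of the product with [1 / (al + be t)] as a geometric series *)
pose a' := fix a' (j : nat) : R := a j / al + (if j is j'.+1 then ga * a' j' else 0).
(* a ratio above [q] and [2 |ga|], so that each of the two terms of the recursion
   takes at most half of the bound *)
pose Q := 2 * (1 + q + `|ga|).
have Q0 : 0 < Q by rewrite mulr_gt0// ltr_wpDr// ltr_wpDr.
pose K' := 2 * K / `|al|.
have K'0 : 0 <= K' by rewrite !mulr_ge0// invr_ge0.
have hK' j : `|a' j| <= K' * Q ^+ j.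
  have qQ i : q ^+ i <= Q ^+ i.
    by apply: lerXn2r; rewrite ?nnegrE ?(ltW Q0)// /Q; have := normr_ge0 ga; lra.
  have aj i : `|a i / al| <= K' / 2 * Q ^+ i.
    rewrite normrM normfV /K' (_ : 2 * K / `|al| / 2 = K / `|al|); last by field; rewrite normr_eq0.
    rewrite [leRHS]mulrAC ler_wpM2r ?invr_ge0// (le_trans (hK i))//.
    exact: ler_wpM2l.
  elim: j => [|j IH].
    by rewrite /= addr0 (le_trans (aj 0%N))// expr0 !mulr1; lra.
  rewrite /= (le_trans (ler_normD _ _))//.
  have : `|ga * a' j| <= K' / 2 * Q ^+ j.+1.
    rewrite normrM exprS (_ : K' / 2 * (Q * Q ^+ j) = (1 + q + `|ga|) * (K' * Q ^+ j)); last first.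
      by rewrite /Q; field.
    by apply: ler_pM => //; lra.
  have := aj j.+1; lra.
move: K' Q K'0 Q0 hK' => K' Q K'0 Q0 hK'.
exists a'; split; first by exists K', Q; split => //; exact: ltW.
have small : \forall t \near (0 : R), `|Q * t| < 1.
  apply/nbhs_ballP; exists Q^-1; first by rewrite /= invr_gt0.
  move=> t; rewrite -ball_normE/= sub0r normrN => tQ.
  by rewrite normrM gtr0_norm// -ltr_pdivlMl// mulr1.
have h2 := nbhs_affine_neq0 be al0.
apply: filterS3 h small h2 => t ht st at0.
(* multiplying a partial sum of the new series by the denominator gives the
   partial sum of the old one, up to its own last term *)
have E n : series (pterm a' t) n.+1 * (al + be * t) =
    series (pterm a t) n.+1 + be * (a' n * t ^+ n) * t.
  elim: n => [|n IH].
    rewrite /series/= !big_nat1 /pterm/= addr0 expr0; field.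
    exact: al0.
  have S b : series (pterm b t) n.+2 = series (pterm b t) n.+1 + b n.+1 * t ^+ n.+1.
    by rewrite /series/= big_nat_recr.
  by rewrite !S mulrDl IH /= exprS /ga; field.
have lim0 : (fun n => be * (a' n * t ^+ n) * t) @ \oo --> (0 : R).
  rewrite -(mul0r t); apply: cvgM; last exact: cvg_cst.
  rewrite -(mulr0 be); apply: cvgM; first exact: cvg_cst.
  apply/cvgr0Pnorm_lt => e e0.
  have g0 : (fun n => K' * (Q * t) ^+ n) @ \oo --> (0 : R).
    rewrite -(mulr0 K'); apply: cvgM; [exact: cvg_cst|exact: cvg_expr].
  have /cvgr0Pnorm_lt /(_ e e0) g1 := g0.
  apply: filterS g1 => n; apply: le_lt_trans.
  rewrite !normrM (ger0_norm K'0) !normrX normrM (gtr0_norm Q0) exprMn mulrA.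
  by rewrite ler_wpM2r// exprn_ge0.
rewrite -(cvg_shiftS (series (pterm a' t))).
rewrite (_ : (fun n => _) = fun n => (series (pterm a t) n.+1 + be * (a' n * t ^+ n) * t) / (al + be * t)).
  apply: cvgM; last exact: cvg_cst.
  rewrite -[f t]addr0; apply: cvgD => //.
  by rewrite (cvg_shiftS (series (pterm a t))).
by apply/funext => n; rewrite -E mulfK.
Unshelve. all: by end_near. Qed.

Lemma pow_exp_laurent f a N : pow_exp f a ->
  exists2 z, is_laurent (fun t => f t / t ^+ N) z & (N = 0%N -> z 0 = f 0).
Proof.
move=> [_ h].
exists (fun k => if 0 <= k + N%:Z then a (absz (k + N%:Z)) else 0).
  have zN (k : int) : k < - N%:Z -> (if 0 <= k + N%:Z then a (absz (k + N%:Z)) else 0) = 0.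
    by move=> kN; rewrite ifF//; apply/negbTE; rewrite -ltNge; lia.
  exists N; apply/(laurent_fromP _ zN).
  have t0 : \forall t \near (0 : R)^', t != 0 by exact: nbhs_dnbhs_neq.
  have h' : \forall t \near (0 : R)^', series (pterm a t) @ \oo --> f t by exact: cvg_within.
  apply: filterS2 t0 h' => t t0.
  rewrite mulrCA divff ?expf_neq0// mulr1; apply: eq_cvgn => n.
  by rewrite /series/=; apply: eq_bigr => j _; rewrite /pterm subrK.
move=> ->; rewrite addr0/=.
have := nbhs_singleton h => /= H.
have : series (pterm a 0) @ \oo --> a 0%N.
  rewrite -(cvg_shiftS (series (pterm a 0))) (_ : (fun n => _) = cst (a 0%N)); first exact: cvg_cst.
  apply/funext => n; rewrite /series/= big_nat_recl// /pterm expr0 mulr1 big1 ?addr0//.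
  by move=> i _; rewrite exprS mul0r mulr0.
by move=> /cvg_unique; apply => //; exact: H.
Qed.

(** Vanishing constant terms [al i] contribute the pole, the other factors are
    invertible power series. *)
Lemma laurent_rational (p : {poly R}) (I : finType) (al be : I -> R) :
  (forall i, exists t, al i + be i * t != 0) ->
  exists2 z, is_laurent (fun t => p.[t] / \prod_i (al i + be i * t)) z &
    (forall i, al i != 0) -> z 0 = p.[0] / \prod_i al i.
Proof.
move=> h.
suff [N [g [a [ga gE N0]]]] : exists N g a, [/\ pow_exp g a,
    (forall t, t != 0 -> p.[t] / \prod_i (al i + be i * t) = g t / t ^+ N) &
    (forall i, al i != 0) -> N = 0%N /\ g 0 = p.[0] / \prod_i al i].
  have [z hz z0] := pow_exp_laurent N ga; exists z.
    apply: is_laurent_ext hz.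
    have t0 : \forall t \near (0 : R)^', t != 0 by exact: nbhs_dnbhs_neq.
    by apply: filterS t0 => t t0; rewrite gE.
  by move=> al0; have [N00 <-] := N0 al0; exact: z0.
rewrite /index_enum; move: (Finite.enum I) => r.
elim: r => [|i r [N [g [a [ga gE N0]]]]].
  exists 0%N, (horner p), (fun j => p`_j); split; first exact: pow_exp_horner.
    by move=> t _; rewrite big_nil expr0.
  by rewrite big_nil divr1.
have [ali|ali] := eqVneq (al i) 0.
  have bei : be i != 0.
    by have [t] := h i; rewrite ali add0r; apply: contraNneq => ->; rewrite mul0r.
  have [a' ga'] := pow_exp_div 0 bei ga.
  exists N.+1, (fun t => g t / (be i + 0 * t)), a'; split => //.
    move=> t t0; rewrite big_cons invfM mulrCA gE// ali add0r mul0r addr0.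
    by rewrite exprS; field; rewrite bei t0 expf_neq0.
  by move=> /(_ i); rewrite ali eqxx.
have [a' ga'] := pow_exp_div (be i) ali ga.
exists N, (fun t => g t / (al i + be i * t)), a'; split => //.
  by move=> t t0; rewrite big_cons invfM mulrCA gE// mulrC mulrAC.
move=> al0; have [-> g0] := N0 al0; split => //.
by rewrite mulr0 addr0 g0 big_cons invfM mulrAC mulrA.
Qed.

End Laurent.

(** * The vertex formula in full dimension *)
Section GenericVector.
Variables (R : realType) (d : nat).

Lemma poly_eq0_inj (p : {poly R}) (f : nat -> R) : injective f ->
  (forall i, p.[f i] = 0) -> p = 0.
Proof.
move=> fi pf; apply/eqP; apply: contraT => p0.
have := max_poly_roots p0 (rs := [seq f i | i <- iota 0 (size p)]).
rewrite size_map size_iota ltnn => -> //; last by rewrite map_inj_uniq// iota_uniq.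
by apply/allP => x /mapP[i _ ->]; rewrite rootE pf.
Qed.

(** The moment curve meets every hyperplane through the origin in finitely many
    points. *)
Lemma generic_vector (vs : seq 'rV[R]_d) : {in vs, forall v, v != 0} ->
  exists w, {in vs, forall v, dotp v w != 0}.
Proof.
move=> vs0.
pose p := \prod_(v <- vs) rVpoly v.
have p0 : p != 0.
  rewrite prodf_seq_neq0; apply/allP => v vvs /=.
  apply: contra (vs0 _ vvs) => /eqP v0; apply/eqP.
  by rewrite -(rVpolyK v) v0 raddf0.
have [i pi] : exists i : nat, p.[i%:R] != 0.
  apply: contrapT => /forallNP h; move/eqP: p0; apply.
  apply: (@poly_eq0_inj _ (fun i => i%:R)) => [i j /eqP|i].
    by rewrite eqr_nat => /eqP.
  by apply/eqP; rewrite -[_ == _]negbK; apply/negP/h.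
exists (\row_j i%:R ^+ j) => v vvs; move: pi; rewrite /p horner_prod.
rewrite prodf_seq_neq0 => /allP /(_ v vvs) /=.
congr (_ != 0); rewrite horner_poly; apply: eq_bigr => j _.
by rewrite mxE valK.
Qed.

End GenericVector.

Section FlipIntegral.
Variables (R : realType) (d : nat).
Local Notation T := (measurableTypeR R).
Local Notation mu := (lebesgue_tuple R d).
Implicit Types (u : 'M[R]_d) (s l w x : 'rV[R]_d).

Definition flip_ind (c tau t : R) : bool := hpos t tau (+) (0 < c).

Lemma flip_funE (c tau t : R) :
  flip_fun c tau t = (if 0 < c then -1 else 1) * (flip_ind c tau t)%:R.
Proof. by rewrite /flip_fun /flip_ind; case: hpos; case: (0 < c) => /=; ring. Qed.

Lemma flip_indE (c tau t : R) : c != 0 -> t != 0 -> flip_ind c tau t = (c * t < 0).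
Proof.
move=> c0 t0; rewrite /flip_ind hposE//; case: (ltrgtP c 0) c0 => // c0 _.
  by rewrite addbF nmulr_rlt0.
by rewrite addbT pmulr_rlt0//; case: ltrgtP t0.
Qed.

Lemma flip_weightE w l s u x : flip_weight w l s u x =
  (\prod_i (if 0 < dotp l (row i u) then -1 else 1)) *
  cone_weight s u (fun i => flip_ind (dotp l (row i u)) ((w *m invmx u) 0 i)) x.
Proof. by rewrite -big_split; apply: eq_bigr => i _; rewrite flip_funE. Qed.

Lemma Rintegral_sum_seq (I : eqType) (r : seq I) (F : I -> d.-tuple T -> R) :
  {in r, forall i, mu.-integrable setT (EFin \o F i)} ->
  mu.-integrable setT (EFin \o (fun t => \sum_(i <- r) F i t)) /\
  \int[mu]_t (\sum_(i <- r) F i t) = \sum_(i <- r) \int[mu]_t F i t.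
Proof.
elim: r => [|i r IH] h.
  rewrite (_ : (fun t => _) = fun=> 0); last by apply/funext => t; rewrite big_nil.
  by rewrite big_nil; split; [exact: integrable0|rewrite /Rintegral integral0].
have [|IH1 IH2] := IH; first by move=> j jr; apply: h; rewrite inE jr orbT.
rewrite (_ : (fun t => _) = fun t => F i t + \sum_(j <- r) F j t); last first.
  by apply/funext => t; rewrite big_cons.
rewrite big_cons; have hi := h i (mem_head _ _); split; last by rewrite RintegralD// IH2.
exact: (integrableD measurableT hi IH1).
Qed.

Lemma measurable_sum_in (I : eqType) (r : seq I) (F : I -> d.-tuple T -> R) :
  {in r, forall i, measurable_fun setT (F i)} ->
  measurable_fun setT (fun t => \sum_(i <- r) F i t).
Proof.
elim: r => [|i r IH] h; first by under eq_fun do rewrite big_nil; exact: measurable_cst.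
under eq_fun do rewrite big_cons; apply: measurable_funD; first exact: h (mem_head _ _).
by apply: IH => j jr; apply: h; rewrite inE jr orbT.
Qed.

Lemma measurable_flip_weight w l s u : (forall i, dotp l (row i u) != 0) ->
  measurable_fun setT (fun t : d.-tuple T => flip_weight w l s u (rowt t)).
Proof.
move=> lu; under eq_fun do rewrite flip_weightE.
apply: measurable_funM => //; apply: (measurable_cone_weight _ _ lu) => i t t0.
exact: flip_indE.
Qed.

Lemma measurable_tpow_dotp k l (h : R) :
  measurable_fun setT (fun t : d.-tuple T => tpow k (dotp l (rowt t) + h)).
Proof. exact: (measurableT_comp (measurable_tpow k) (measurable_dotp l h)). Qed.

Lemma integral_flip k w l s u (h : R) : u \in unitmx ->
  (forall i, dotp l (row i u) != 0) ->
  let G := fun t : d.-tuple T => flip_weight w l s u (rowt t) * tpow k (dotp l (rowt t) + h) in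
  mu.-integrable setT (EFin \o G) /\
  \int[mu]_t G t = k`!%:R / (k + d)`!%:R * frame_vol u * tpow (k + d) (dotp l s + h) /
    \prod_i (- dotp l (row i u)).
Proof.
move=> uu lu G.
pose b i := flip_ind (dotp l (row i u)) ((w *m invmx u) 0 i).
have bE i (t : R) : t != 0 -> b i t = (dotp l (row i u) * t < 0) by exact: flip_indE.
pose F (t : d.-tuple T) : R := cone_weight s u b (rowt t) * tpow k (dotp l (rowt t) + h).
have F0 t : 0 <= F t by rewrite mulr_ge0 ?prodr_ge0// tpow_ge0.
have FE := integral_tpow_cone k s h uu lu bE.
have iF : mu.-integrable setT (EFin \o F).
  apply/integrableP; split.
    apply/measurable_EFinP; apply: measurable_funM; last exact: measurable_tpow_dotp.
    exact: (measurable_cone_weight s u lu bE).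
  under eq_integral do rewrite /= ger0_norm//.
  by rewrite FE ltry.
pose sg : R := \prod_i (if 0 < dotp l (row i u) then -1 else 1).
have GE : G = fun t => sg * F t.
  by apply/funext => t; rewrite /G flip_weightE mulrA.
rewrite GE; split.
  rewrite (_ : _ \o _ = fun t => sg%:E * (EFin \o F) t)%E//.
  exact: integrableZl.
rewrite RintegralZl// /Rintegral FE/= mulrCA; congr (_ * _).
rewrite /sg -prodfV -prodfV -big_split; apply: eq_bigr => i _ /=.
case: (ltrgtP (dotp l (row i u)) 0) (lu i) => // c0 _.
  by rewrite ltr0_norm// mul1r.
by rewrite gtr0_norm// mulN1r invrN.
Qed.

End FlipIntegral.

Section BrionGeneric.
Variables (R : realType) (d m : nat).
Local Notation T := (measurableTypeR R).
Local Notation mu := (lebesgue_tuple R d).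
Local Notation E := 'rV[R]_d.
Variables (A : 'I_m -> E) (b : 'I_m -> R).
Local Notation P := (Hpoly A b).
Local Notation PT := (@rowt R d @^-1` P).
Implicit Types (u : 'M[R]_d) (s l w x : E).

Lemma measurable_dotp0 l : measurable_fun setT (fun t : d.-tuple T => dotp l (rowt t)).
Proof. by have := measurable_dotp l 0; under eq_fun do rewrite addr0. Qed.

Lemma measurable_Hpoly : measurable PT.
Proof.
rewrite (_ : PT = \bigcap_(j in [set: 'I_m]) [set t : d.-tuple T | dotp (A j) (rowt t) <= b j]).
  apply: fin_bigcap_measurable => [|j _]; first exact: finite_finset.
  have := measurable_dotp (A j) 0 measurableT (measurable_itv `]-oo, b j]).
  by rewrite setTI; congr measurable; apply/seteqP; split => t /=; rewrite addr0 in_itv.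
by apply/seteqP; split => [t h j _|t h j]; exact: h.
Qed.

(** Only points on the boundary hyperplanes can be lost by the displacement. A zero
    row defines no hyperplane, but its constraint holds everywhere or nowhere. *)
Lemma Hpoly_inw_ae w : {ae mu, forall t, `[< inw w P (rowt t) >] = `[< P (rowt t) >]}.
Proof.
have h : {ae mu, forall t, forall j, A j != 0 -> dotp (A j) (rowt t) != b j}.
  apply: (@filter_forall _ _ (fun j t => A j != 0 -> dotp (A j) (rowt t) != b j)) => j.
  have [->|Aj] := eqVneq (A j) 0; first by apply: filterE.
  exists [set t | dotp (A j) (rowt t) = b j]; split.
  - exact: measurable_hyperplane.
  - exact: null_hyperplane.
  - by move=> t /= /not_implyP[_ /negP/negPn/eqP].
apply: filterS h => t h; apply: asbool_equiv_eq; split; first exact: inw_sub.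
move=> Pt; have [e e0 He] := local_active Pt.
have xx : `|rowt t - rowt t| < e by rewrite subrr normr0.
apply: filterS (ball_shift_near w xx) => y yt; apply/(He _ yt) => j /eqP tj.
have [->|Aj] := eqVneq (A j) 0; first by rewrite dotpC dotp0r.
by have := h j Aj; rewrite tj eqxx.
Qed.

Lemma Rintegral_Hpoly_inw w k l (h : R) :
  measurable_fun setT (fun t : d.-tuple T => `[< inw w P (rowt t) >]%:R : R) ->
  (forall x, P x -> 0 <= dotp l x + h) ->
  \int[mu]_(t in PT) (dotp l (rowt t) + h) ^+ k =
  \int[mu]_t (`[< inw w P (rowt t) >]%:R * tpow k (dotp l (rowt t) + h)).
Proof.
move=> mw Ph; congr fine.
transitivity (\int[mu]_t (\1_PT t * tpow k (dotp l (rowt t) + h))%:E)%E.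
  rewrite integral_mkcond; apply: eq_integral => t _.
  rewrite patchE indicE; case: ifPn => tP; last by rewrite mul0r.
  by rewrite mul1r /tpow Ph//; move: tP; rewrite inE.
have mt := measurable_tpow_dotp k l h.
apply: ge0_ae_eq_integral => //.
- apply/measurable_EFinP; apply: measurable_funM => //.
  exact: (measurable_indic measurable_Hpoly).
- by apply/measurable_EFinP; apply: measurable_funM.
- by move=> t _; rewrite lee_fin mulr_ge0// tpow_ge0.
- by move=> t _; rewrite lee_fin mulr_ge0// tpow_ge0.
apply: filterS (Hpoly_inw_ae w) => t -> _.
by rewrite indicE; congr ((nat_of_bool _)%:R * _)%:E; apply/idP/asboolP; rewrite inE.
Qed.

Lemma Rintegral_poly (D : set (d.-tuple T)) (g q : d.-tuple T -> R) (k : nat) (K : R) :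
  measurable D -> (mu D < +oo)%E ->
  measurable_fun setT g -> measurable_fun setT q ->
  (forall t, D t -> `|g t| <= K /\ `|q t| <= K) ->
  exists p : {poly R}, forall e, \int[mu]_(t in D) (g t + e * q t) ^+ k = p.[e].
Proof.
move=> mD fD mg mq bD.
pose F i t : R := g t ^+ (k - i) * q t ^+ i *+ 'C(k, i).
have iF i : mu.-integrable D (EFin \o F i).
  apply: measurable_bounded_integrable => //.
    apply: measurable_funTS; rewrite /F; under eq_fun do rewrite -mulr_natr.
    by apply: measurable_funM => //; apply: measurable_funM; apply: measurable_funX.
  exists (K ^+ (k - i) * K ^+ i *+ 'C(k, i)); split; first exact: num_real.
  move=> M KM t /bD[gK qK]; apply: le_trans (ltW KM).
  rewrite /F normrMn lerMn2r; apply/orP; right.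
  by rewrite normrM !normrX; apply: ler_pM; rewrite ?exprn_ge0//; apply: lerXn2r; rewrite ?nnegrE// (le_trans _ gK).
have S n e : mu.-integrable D (EFin \o (fun t => \sum_(i < n) e ^+ i * F i t)) /\
    \int[mu]_(t in D) (\sum_(i < n) e ^+ i * F i t) =
    \sum_(i < n) e ^+ i * \int[mu]_(t in D) F i t.
  elim: n => [|n [IH1 IH2]].
    rewrite (_ : (fun t => _) = fun=> 0); last by apply/funext => t; rewrite big_ord0.
    by rewrite big_ord0; split; [exact: integrable0|rewrite /Rintegral integral0].
  rewrite (_ : (fun t => _) = fun t => \sum_(i < n) e ^+ i * F i t + e ^+ n * F n t); last first.
    by apply/funext => t; rewrite big_ord_recr.
  have ien : mu.-integrable D (EFin \o (fun t => e ^+ n * F n t)).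
    exact: (integrableZl mD (e ^+ n) (iF n)).
  rewrite big_ord_recr/=; split; last by rewrite RintegralD// IH2 RintegralZl.
  exact: (integrableD mD IH1 ien).
exists (\sum_(i < k.+1) (\int[mu]_(t in D) F i t)%:P * 'X^i) => e.
rewrite horner_sum; under [RHS]eq_bigr do rewrite hornerM hornerC hornerXn mulrC.
have [_ <-] := S k.+1 e; apply: eq_Rintegral => t _.
rewrite exprDn; apply: eq_bigr => i _.
by rewrite /F exprMn -!mulrnAr; ring.
Qed.

(** The value of the cone term with apex [s] and generators the rows of [u], for the
    affine function [<l, x> + h] in place of the linear form. *)
Definition brion_term k l (h : R) s u : R :=
  k`!%:R / (k + d)`!%:R * frame_vol u * (dotp l s + h) ^+ (k + d) /
    \prod_i (- dotp l (row i u)).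

Definition regular_frames l (S : seq E) (D : E -> seq 'M[R]_d) :=
  {in S, forall s, {in D s, forall u i, dotp l (row i u) != 0}}.

Lemma mu_Hpoly_lty : (exists K, forall x, P x -> `|x| <= K) -> (mu PT < +oo)%E.
Proof.
move=> [K hK]; apply: (@bounded_mu_lty _ _ _ K); first exact: measurable_Hpoly.
by move=> t /hK tK i; apply: le_trans tK; exact: normr_coord.
Qed.

Lemma dotp_bounded_Hpoly l : (exists K, forall x, P x -> `|x| <= K) ->
  exists K, forall x, P x -> `|dotp l x| <= K.
Proof.
move=> [K hK]; exists (dotp_bound l * K) => x /hK xK.
by rewrite (le_trans (normr_dotp _ _))// ler_wpM2l// ltW// dotp_bound_gt0.
Qed.

(** For [h] large the truncation in [integral_flip] is invisible on [P], so that the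
    flip identity can be integrated; both sides are polynomials in [h]. *)
Lemma brion_generic k l (S : seq E) (D : E -> seq 'M[R]_d) :
  uniq S -> {in S, forall s, P s} ->
  {in S, forall s, frame_cover (feasible_cone P s) (D s)} ->
  regular_frames l S D ->
  (forall p, P p -> p \notin S -> exists2 v, dotp l v != 0 &
    forall j, active A b p j -> dotp (A j) v = 0) ->
  (exists K, forall x, P x -> `|x| <= K) ->
  forall h, \int[mu]_(t in PT) (dotp l (rowt t) + h) ^+ k =
    \sum_(s <- S) \sum_(u <- D s) brion_term k l h s u.
Proof.
move=> uS PS covS lS nvS bP.
have [w hw] : exists w, {in S, forall s, {in D s, forall u, generic_frame w u}}.
  have [|w hw] := @generic_vector R d
      (flatten [seq flatten [seq [seq (col i (invmx u))^T | i <- enum 'I_d] | u <- D s] | s <- S]).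
    move=> v /flatten_mapP[s sS /flatten_mapP[u us /mapP[i _ ->]]].
    have [_ unitD _ _] := covS _ sS; have uu := unitD _ us.
    apply/eqP => /(congr1 trmx); rewrite trmxK trmx0 => ci.
    have := congr1 (fun M : 'cV_d => (u *m M) i 0) ci.
    rewrite colE mulmxA mulmxV// mul1mx mulmx0 !mxE !eqxx => /eqP.
    by rewrite oner_eq0.
  exists w => s sS u us i; have := hw (col i (invmx u))^T.
  have -> : (w *m invmx u) 0 i = dotp (col i (invmx u))^T w.
    by rewrite mxE; apply: eq_bigr => j _; rewrite !mxE mulrC.
  apply; apply/flatten_mapP; exists s => //; apply/flatten_mapP; exists u => //.
  by apply/mapP; exists i => //; rewrite mem_enum.
have flip := flip_identity uS PS covS hw lS nvS bP.
have [K hK] := dotp_bounded_Hpoly l bP.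
have large h : K <= h -> \int[mu]_(t in PT) (dotp l (rowt t) + h) ^+ k =
    \sum_(s <- S) \sum_(u <- D s) brion_term k l h s u.
  move=> Kh.
  have Ph x : P x -> 0 <= dotp l x + h.
    by move=> /hK; rewrite ler_norml => /andP[+ _]; lra.
  rewrite (@Rintegral_Hpoly_inw w)//; last first.
    under eq_fun do rewrite flip.
    apply: measurable_sum_in => s sS; apply: measurable_sum_in => u us.
    exact: (measurable_flip_weight w s (lS _ sS _ us)).
  transitivity (\int[mu]_t \sum_(s <- S) \sum_(u <- D s)
      (flip_weight w l s u (rowt t) * tpow k (dotp l (rowt t) + h))).
    apply: eq_Rintegral => t _; rewrite flip mulr_suml; apply: eq_bigr => s _.
    by rewrite mulr_suml.
  have intu s : s \in S -> mu.-integrable setT (EFin \o (fun t => \sum_(u <- D s)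
       flip_weight w l s u (rowt t) * tpow k (dotp l (rowt t) + h))) /\
     \int[mu]_t (\sum_(u <- D s) flip_weight w l s u (rowt t) * tpow k (dotp l (rowt t) + h)) =
     \sum_(u <- D s) brion_term k l h s u.
    move=> sS; have [_ unitD _ _] := covS _ sS.
    have [|i1 i2] := @Rintegral_sum_seq R d _ (D s)
      (fun u t => flip_weight w l s u (rowt t) * tpow k (dotp l (rowt t) + h)).
      by move=> u us; have [] := integral_flip k w s h (unitD _ us) (lS _ sS _ us).
    split => //; rewrite i2 big_seq [RHS]big_seq; apply: eq_bigr => u us.
    have [_ ->] := integral_flip k w s h (unitD _ us) (lS _ sS _ us).
    by rewrite /brion_term /tpow Ph//; exact: PS.
  have [|_ ->] := @Rintegral_sum_seq R d _ S
    (fun s t => \sum_(u <- D s) flip_weight w l s u (rowt t) * tpow k (dotp l (rowt t) + h)).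
    by move=> s /intu[].
  by rewrite big_seq [RHS]big_seq; apply: eq_bigr => s /intu[].
have mc : measurable_fun setT ((fun=> 1) : d.-tuple T -> R) by exact: measurable_cst.
have [|p hp] := @Rintegral_poly PT (fun t => dotp l (rowt t)) (fun=> 1) k (Num.max K 1)
    measurable_Hpoly (mu_Hpoly_lty bP) (measurable_dotp0 l) mc.
  by move=> t /hK tK; rewrite normr1 !le_max tK lexx orbT.
pose c s u : R := k`!%:R / (k + d)`!%:R * frame_vol u / \prod_i (- dotp l (row i u)).
pose q : {poly R} := \sum_(s <- S) \sum_(u <- D s) c s u *: ((dotp l s)%:P + 'X) ^+ (k + d).
have qE h : q.[h] = \sum_(s <- S) \sum_(u <- D s) brion_term k l h s u.
  rewrite horner_sum; apply: eq_bigr => s _; rewrite horner_sum; apply: eq_bigr => u _.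
  by rewrite hornerZ horner_exp hornerD hornerC hornerX /c /brion_term; ring.
have pE h : \int[mu]_(t in PT) (dotp l (rowt t) + h) ^+ k = p.[h].
  by rewrite -hp; apply: eq_Rintegral => t _; rewrite mulr1.
suff pq : p = q by move=> h; rewrite pE pq qE.
apply/eqP; rewrite -subr_eq0; apply/eqP.
apply: (@poly_eq0_inj _ _ (fun i => K + i%:R)) => [i j /addrI/eqP|i].
  by rewrite eqr_nat => /eqP.
by rewrite hornerD hornerN -pE large ?lerDl// -qE subrr.
Qed.

Lemma dnbhs_affine_neq0 (al be : R) : (exists t, al + be * t != 0) ->
  \forall e \near 0^', al + be * e != 0.
Proof.
move=> [t ht]; have t0 : \forall e \near (0 : R)^', e != 0 by exact: nbhs_dnbhs_neq.
have [al0|al0] := eqVneq al 0.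
  have be0 : be != 0 by apply: contraNneq ht => ->; rewrite al0 mul0r addr0.
  by apply: filterS t0 => e e0; rewrite al0 add0r mulf_neq0.
have := nbhs_affine_neq0 be al0; exact: cvg_within.
Qed.

Lemma dnbhs_in_seq (I : eqType) (r : seq I) (F : I -> R -> Prop) :
  (forall i, i \in r -> \forall e \near 0^', F i e) ->
  \forall e \near 0^', forall i, i \in r -> F i e.
Proof.
elim: r => [_|i r IH h]; first by apply: filterE.
have h1 := h i (mem_head _ _).
have h2 : \forall e \near 0^', forall i, i \in r -> F i e.
  by apply: IH => j jr; apply: h; rewrite inE jr orbT.
by apply: filterS2 h1 h2 => e k1 k2 j; rewrite inE => /predU1P[->//|/k2].
Qed.

Lemma horner_laurent (q : {poly R}) : exists2 z, is_laurent (horner q) z & z 0 = q.[0].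
Proof.
have [|z hz z0] := @laurent_rational R q 'I_0 (fun=> 0) (fun=> 0); first by case.
exists z; last by rewrite z0 ?big_ord0 ?divr1//; case.
by apply: is_laurent_ext hz; apply: filterE => t; rewrite big_ord0 divr1.
Qed.

Lemma brion_term_laurent k l a (h h' : R) s u :
  (forall i, exists t, dotp l (row i u) + t * dotp a (row i u) != 0) ->
  exists2 z, is_laurent (fun e => brion_term k (l + e *: a) (h + e * h') s u) z &
    (forall i, dotp l (row i u) != 0) -> z 0 = brion_term k l h s u.
Proof.
move=> hl.
pose p : {poly R} := ((dotp l s + h)%:P + (dotp a s + h') *: 'X) ^+ (k + d).
have [|z hz z0] := @laurent_rational R p 'I_d (fun i => - dotp l (row i u))
    (fun i => - dotp a (row i u)).
  move=> i; have [t ht] := hl i; exists t.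
  by rewrite mulNr -opprD oppr_eq0 mulrC.
exists (fun j => (k`!%:R / (k + d)`!%:R * frame_vol u) * z j).
  apply: is_laurent_ext (is_laurentZ _ hz); apply: filterE => e.
  rewrite /brion_term mulrA; congr (_ * _ / _).
    rewrite horner_exp hornerD hornerZ hornerC hornerX dotpDl dotpZl; congr (_ ^+ _); ring.
  by apply: eq_bigr => i _; rewrite dotpDl dotpZl; ring.
move=> lu; rewrite z0; last by move=> i; rewrite oppr_eq0.
by rewrite /brion_term mulrA horner_exp hornerD hornerZ hornerC hornerX mulr0 addr0.
Qed.

(** Both sides have Laurent expansions along a line, so that an identity valid near
    a point passes to constant terms. *)
Lemma brion_limit k l a (h h' : R) (S : seq E) (D : E -> seq 'M[R]_d) Z :
  (exists K, forall x, P x -> `|x| <= K) ->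
  (\forall e \near 0^', \int[mu]_(t in PT) (dotp (l + e *: a) (rowt t) + (h + e * h')) ^+ k =
    \sum_(s <- S) \sum_(u <- D s) brion_term k (l + e *: a) (h + e * h') s u) ->
  {in S, forall s, {in D s, forall u,
    is_laurent (fun e => brion_term k (l + e *: a) (h + e * h') s u) (Z s u)}} ->
  \int[mu]_(t in PT) (dotp l (rowt t) + h) ^+ k =
    \sum_(s <- S) \sum_(u <- D s) Z s u 0.
Proof.
move=> bP near hZ.
have [K hK] := dotp_bounded_Hpoly l bP; have [K' hK'] := dotp_bounded_Hpoly a bP.
have [|q hq] := @Rintegral_poly PT (fun t => dotp l (rowt t) + h)
    (fun t => dotp a (rowt t) + h') k (Num.max (K + `|h|) (K' + `|h'|))
    measurable_Hpoly (mu_Hpoly_lty bP) (measurable_dotp l h) (measurable_dotp a h').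
  move=> t Pt; rewrite !le_max; split; apply/orP; [left|right];
    rewrite (le_trans (ler_normD _ _))// lerD2r.
    exact: hK.
  exact: hK'.
have qE e : \int[mu]_(t in PT) (dotp (l + e *: a) (rowt t) + (h + e * h')) ^+ k = q.[e].
  by rewrite -hq; apply: eq_Rintegral => t _; rewrite dotpDl dotpZl; congr (_ ^+ _); ring.
have q0 : \int[mu]_(t in PT) (dotp l (rowt t) + h) ^+ k = q.[0].
  by rewrite -qE; apply: eq_Rintegral => t _; rewrite scale0r mul0r !addr0.
have [zq hzq zq0] := horner_laurent q.
have hS : is_laurent (fun e => \sum_(s <- S) \sum_(u <- D s)
    brion_term k (l + e *: a) (h + e * h') s u)
    (fun j => \sum_(s <- S) \sum_(u <- D s) Z s u j).
  apply: is_laurent_sum => s sS; apply: is_laurent_sum => u us; exact: (hZ _ sS _ us).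
have hq' : is_laurent (horner q) (fun j => \sum_(s <- S) \sum_(u <- D s) Z s u j).
  by apply: is_laurent_ext hS; apply: filterS near => e <-; rewrite qE.
by rewrite q0 -zq0 (is_laurent_uniq hzq hq').
Qed.

Definition nonvertex_line p := exists2 v, v != 0 & forall j, active A b p j -> dotp (A j) v = 0.

(** Finitely many lines suffice, one for each set of active constraints. *)
Lemma nonvertex_lines : exists2 vs : seq E, {in vs, forall v, v != 0} &
  forall p, nonvertex_line p -> exists2 v, v \in vs & forall j, active A b p j -> dotp (A j) v = 0.
Proof.
pose good (J : {set 'I_m}) := [set v : E | v != 0 /\ forall j, j \in J -> dotp (A j) v = 0].
exists [seq v <- [seq xget 0 (good J) | J : {set 'I_m}] | v != 0].
  by move=> v; rewrite mem_filter => /andP[].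
move=> p [v v0 Av]; pose J := [set j | active A b p j]%SET.
have [w0 wJ] : good J (xget 0 (good J)).
  by apply: xgetPex; exists v; split => // j; rewrite inE; exact: Av.
exists (xget 0 (good J)); last by move=> j pj; apply: wJ; rewrite inE.
by rewrite mem_filter w0/=; apply/mapP; exists J => //; rewrite mem_enum.
Qed.

(** A generic perturbation [l + e a] is nonzero on the lines through the points that
    are not vertices and stays regular, so that [brion_generic] applies to it for
    small [e <> 0]. *)
Theorem brion_regular k l (S : seq E) (D : E -> seq 'M[R]_d) :
  uniq S -> {in S, forall s, P s} ->
  {in S, forall s, frame_cover (feasible_cone P s) (D s)} ->
  regular_frames l S D ->
  (forall p, P p -> p \notin S -> nonvertex_line p) ->
  (exists K, forall x, P x -> `|x| <= K) ->
  forall h, \int[mu]_(t in PT) (dotp l (rowt t) + h) ^+ k =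
    \sum_(s <- S) \sum_(u <- D s) brion_term k l h s u.
Proof.
move=> uS PS covS lS nvS bP h.
have [vs vs0 hvs] := nonvertex_lines.
have [a ha] := generic_vector vs0.
have zex s u : exists z, s \in S -> u \in D s ->
    is_laurent (fun e => brion_term k (l + e *: a) (h + e * 0) s u) z /\
    z 0 = brion_term k l h s u.
  have [[sS us]|ns] := pselect (s \in S /\ u \in D s); last by exists (fun=> 0) => sS us; case: ns.
  have [|z hz z0] := @brion_term_laurent k l a h 0 s u.
    by move=> i; exists 0; rewrite mul0r addr0; exact: (lS _ sS _ us).
  by exists z => _ _; split => //; apply: z0; exact: (lS _ sS _ us).
pose Z s u := sval (cid (zex s u)).
have hZ s u := svalP (cid (zex s u)).
rewrite (@brion_limit k l a h 0 S D Z bP); last 2 first.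
- have nS : \forall e \near 0^', forall s, s \in S -> forall u, u \in D s ->
      forall i, i \in enum 'I_d -> dotp (l + e *: a) (row i u) != 0.
    apply: dnbhs_in_seq => s sS; apply: dnbhs_in_seq => u us; apply: dnbhs_in_seq => i _.
    have : \forall e \near 0^', dotp l (row i u) + dotp a (row i u) * e != 0.
      by apply: dnbhs_affine_neq0; exists 0; rewrite mulr0 addr0; exact: (lS _ sS _ us).
    by apply: filterS => e; rewrite dotpDl dotpZl mulrC.
  have nv : \forall e \near 0^', forall v, v \in vs -> dotp (l + e *: a) v != 0.
    apply: dnbhs_in_seq => v vvs.
    have : \forall e \near 0^', dotp l v + dotp a v * e != 0.
      apply: dnbhs_affine_neq0; have av0 : dotp a v != 0 by rewrite dotpC; exact: ha.
      by exists ((1 - dotp l v) / dotp a v); rewrite mulrC divfK// addrC subrK oner_eq0.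
    by apply: filterS => e; rewrite dotpDl dotpZl mulrC.
  apply: filterS2 nS nv => e eS ev; apply: brion_generic => //.
    by move=> s sS u us i; apply: (eS s sS u us); rewrite mem_enum.
  move=> p Pp pS; have [v vvs Av] := hvs p (nvS p Pp pS).
  by exists v => //; exact: ev.
- by move=> s sS u us; have [] := hZ s u sS us.
rewrite big_seq [RHS]big_seq; apply: eq_bigr => s sS.
rewrite big_seq [RHS]big_seq; apply: eq_bigr => u us.
by have [] := hZ s u sS us.
Qed.

(** The forms [l + e a] are regular for small [e <> 0], whether or not [l] is. *)
Theorem brion_laurent k l a (h h' : R) (S : seq E) (D : E -> seq 'M[R]_d) Z :
  uniq S -> {in S, forall s, P s} ->
  {in S, forall s, frame_cover (feasible_cone P s) (D s)} ->
  (forall p, P p -> p \notin S -> nonvertex_line p) ->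
  (exists K, forall x, P x -> `|x| <= K) ->
  {in S, forall s, {in D s, forall u i, exists t, dotp l (row i u) + t * dotp a (row i u) != 0}} ->
  {in S, forall s, {in D s, forall u,
    is_laurent (fun e => brion_term k (l + e *: a) (h + e * h') s u) (Z s u)}} ->
  \int[mu]_(t in PT) (dotp l (rowt t) + h) ^+ k =
    \sum_(s <- S) \sum_(u <- D s) Z s u 0.
Proof.
move=> uS PS covS nvS bP laS hZ; apply: (brion_limit bP _ hZ).
have nS : \forall e \near 0^', forall s, s \in S -> forall u, u \in D s ->
    forall i, i \in enum 'I_d -> dotp (l + e *: a) (row i u) != 0.
  apply: dnbhs_in_seq => s sS; apply: dnbhs_in_seq => u us; apply: dnbhs_in_seq => i _.
  have : \forall e \near 0^', dotp l (row i u) + dotp a (row i u) * e != 0.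
    by apply: dnbhs_affine_neq0; have [t ht] := laS _ sS _ us i; exists t; rewrite mulrC.
  by apply: filterS => e; rewrite dotpDl dotpZl mulrC.
apply: filterS nS => e eS; apply: brion_regular => //.
by move=> s sS u us i; apply: (eS s sS u us); rewrite mem_enum.
Qed.

End BrionGeneric.

(** * Lattice bases and parallelepipeds *)
Section Lattice.
Variables (R : realType) (d n : nat).
Local Notation V := 'rV[R]_n.

Lemma toRM m p q (M : 'M[int]_(m, p)) (N : 'M[int]_(p, q)) :
  toR R (M *m N) = toR R M *m toR R N.
Proof. by rewrite /toR map_mxM. Qed.

Lemma toR_inj m p : injective (@toR R m p).
Proof.
move=> M N /matrixP MN; apply/matrixP => i j.
by have := MN i j; rewrite !mxE => /intr_inj.
Qed.

(** In the Smith normal form [u = L * S * N] the first [d] rows of the unimodular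
    matrix [N] are a basis of the integral points of the row space of [u]. *)
Lemma lattice_basis_exists (u : 'M[int]_(d, n)) : row_free (toR R u) ->
  exists B, @is_lattice_basis R n d [set v : V | (v <= toR R u)%MS] B.
Proof.
move=> fu; have dn : (d <= n)%N by rewrite -(eqP fu) rank_leq_col.
have [L uL [N uN [e _ uE]]] := int_Smith_normal_form u.
pose J : 'M[int]_(d, n) := pid_mx d.
have JJ : J *m J^T = 1%:M.
  by rewrite /J tr_pid_mx mul_pid_mx minnn (minn_idPr dn) pid_mx_1.
pose B := J *m N.
pose G := L *m diag_mx (\row_i e`_i).
have uGB : u = G *m B.
  rewrite uE /G /B mulmxA; congr (_ *m N); rewrite -mulmxA; congr (_ *m _).
  apply/matrixP => i j; rewrite mul_diag_mx !mxE ltn_ord andbT.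
  by case: eqP => _; rewrite ?mulr1n ?mulr0n ?mulr1 ?mulr0.
have rB : \rank (toR R B) = d.
  apply/eqP; rewrite eqn_leq rank_leq_row -{1}(eqP fu) uGB toRM mxrankM_maxr//.
have uB : (toR R u <= toR R B)%MS by rewrite uGB toRM submxMl.
have Bu : (toR R B <= toR R u)%MS.
  have /mxrank_leqif_eq := uB; rewrite rB (eqP fu) => -[_].
  by rewrite eqxx => /esym/andP[].
exists B; split; first by rewrite /row_free rB.
move=> z /=; split=> [zu|[w ->]]; last first.
  by rewrite toRM (submx_trans (submxMl _ _) Bu).
have /submxP[y zy] := submx_trans zu uB.
exists (z *m invmx N *m J^T); apply: toR_inj.
have zN : toR R (z *m invmx N) = y *m toR R J.
  by rewrite toRM zy /B toRM -!mulmxA -toRM mulmxV// /toR map_mx1 mulmx1.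
rewrite toRM (toRM _ J^T) zN zy; congr (_ *m _).
by rewrite -mulmxA -toRM JJ /toR map_mx1 mulmx1.
Qed.

End Lattice.

Section AffineHull.
Variables (R : realType) (n : nat).
Local Notation V := 'rV[R]_n.
Implicit Types (Q : set V) (x y v : V).

Lemma sub_affine_hull Q x : Q x -> affine_hull Q x.
Proof.
by move=> Qx; exists 1%N, (fun=> x), (fun=> 1); split=> //; rewrite big_ord1 ?scale1r.
Qed.

Lemma affine_hull2 Q x y (c : R) : Q x -> Q y -> affine_hull Q (c *: x + (1 - c) *: y).
Proof.
move=> Qx Qy; exists 2%N, (fun i => if i == ord0 then x else y), (fun i => if i == ord0 then c else 1 - c).
split; first by move=> i; case: ifP.
  by rewrite big_ord_recl big_ord1/= addrC subrK.
by rewrite big_ord_recl big_ord1.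
Qed.

Lemma direction_sub Q x y : Q x -> Q y -> direction Q (x - y).
Proof. by move=> Qx Qy; exists x, y; split=> //; exact: sub_affine_hull. Qed.

Lemma has_dim_nonempty Q d : has_dim Q d -> exists x, Q x.
Proof.
move=> [W _ QW]; have : direction Q 0 by rewrite QW /= sub0mx.
move=> [x [_ [[[|k] [p [c [Qp c1 _]]]] _ _]]]; last by exists (p ord0).
by move: c1; rewrite big_ord0 => /eqP; rewrite eq_sym oner_eq0.
Qed.

Lemma affine_hull_subspace Q m (W : 'M[R]_(m, n)) x : (forall y, Q y -> (y <= W)%MS) ->
  affine_hull Q x -> (x <= W)%MS.
Proof.
move=> QW [k [p [c [Qp _ ->]]]]; apply: summx_sub => i _.
by apply: scalemx_sub; exact: QW.
Qed.

End AffineHull.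

Section Parallelepiped.
Variables (R : realType) (n d : nat).
Local Notation V := 'rV[R]_n.
Implicit Types (u : 'M[int]_(d, n)).

(** A vector of the span is the difference of two vectors with nonnegative
    coordinates; dividing these by a large [K] brings them into the parallelepiped,
    whose affine hull contains their multiples since it contains [0]. *)
Lemma direction_parallelepiped u :
  direction (@parallelepiped R n d u) = [set v : V | (v <= toR R u)%MS].
Proof.
apply/seteqP; split=> [v [x [y [hx hy ->]]]|v /submxP[t ->]] /=.
  have Qu z : @parallelepiped R n d u z -> (z <= toR R u)%MS by move=> [t _ ->]; exact: submxMl.
  by rewrite addmx_sub// ?eqmx_opp; apply: (affine_hull_subspace Qu).
pose K := 1 + \sum_i `|t 0 i|.
have K0 : 0 < K by rewrite ltr_wpDr// sumr_ge0.
have tK i : `|t 0 i| < K.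
  by rewrite /K (bigD1 i)//= addrCA ltrDl ltr_wpDr// sumr_ge0.
have Q0 : @parallelepiped R n d u 0.
  by exists 0; rewrite ?mul0mx// => i; rewrite mxE lexx ltr01.
pose q (s : R) : V := (\row_i (Num.max 0 (s * t 0 i) / K)) *m toR R u.
have Qq s : `|s| = 1 -> @parallelepiped R n d u (q s).
  move=> s1; exists (\row_i (Num.max 0 (s * t 0 i) / K)) => // i.
  rewrite mxE divr_ge0 ?le_max ?lexx ?(ltW K0)//= ltr_pdivrMr// mul1r gt_max K0/=.
  by rewrite (le_lt_trans (ler_norm _))// normrM s1 mul1r.
exists (K *: q 1 + (1 - K) *: 0), (K *: q (-1) + (1 - K) *: 0); split.
- by apply: affine_hull2 => //; apply: Qq; rewrite normr1.
- by apply: affine_hull2 => //; apply: Qq; rewrite normrN normr1.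
- rewrite !scaler0 !addr0 -scalerBr -mulmxBl scalemxAl; congr (_ *m _).
  apply/rowP => i; rewrite !mxE -mulrBl mulrC divfK ?gt_eqF//.
  rewrite mul1r mulN1r; case: (ltrgtP (t 0 i) 0) => [ti|ti|->].
  + by rewrite max_r ?oppr_ge0 ?(ltW ti)// sub0r opprK.
  + by rewrite max_l ?oppr_le0 ?(ltW ti)// subr0.
  + by rewrite oppr0 maxxx subrr.
Qed.

(** The chart of the parallelepiped has an unspecified base point, which amounts to a
    translation. *)
Lemma vol_parallelepiped u (B : 'M[int]_(d, n)) (U : 'M[R]_d) :
  B = @lattice_basis R n d [set v : V | (v <= toR R u)%MS] -> row_free (toR R B) ->
  U \in unitmx -> toR R u = U *m toR R B ->
  @vol R n d (@parallelepiped R n d u) = frame_vol U.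
Proof.
move=> BE fB uU uUB; rewrite /vol; set Q := @parallelepiped R n d u.
have [t1 _ x1E] : Q (xget 0 Q).
  apply: xgetPex; exists 0; exists 0; rewrite ?mul0mx// => i; rewrite mxE lexx ltr01//.
pose z : 'rV[R]_d := t1 *m U.
pose F : set (d.-tuple (measurableTypeR R)) :=
  [set t | forall i, 0 <= (rowt t *m invmx U) 0 i < 1].
have mF : measurable F by exact: measurable_frame.
have chartE t : chart Q t = (rowt t + z) *m toR R B.
  by rewrite /chart /Q direction_parallelepiped -BE x1E uUB mulmxA mulmxDl addrC.
have -> : @chart R n d Q @^-1` Q = (fun t => trow (rowt t + z)) @^-1` F.
  apply/seteqP; split=> t /=; rewrite chartE /F /= trowK.
    move=> [s s01]; rewrite uUB mulmxA => /(row_free_inj fB) -> i.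
    by rewrite mulmxK.
  move=> h; exists ((rowt t + z) *m invmx U) => //.
  by rewrite uUB mulmxA mulmxKV.
rewrite /frame_vol -/F; congr fine.
have mI : measurable_fun setT (fun t => (\1_F t)%:E : \bar R).
  by apply/measurable_EFinP; exact: (measurable_indic mF).
have F0 t : (0 <= (\1_F t)%:E :> \bar R)%E by rewrite lee_fin.
have H := ge0_integral_tuple_shift z mI F0.
transitivity (\int[lebesgue_tuple R d]_t (\1_((fun t => trow (rowt t + z)) @^-1` F) t)%:E)%E.
  rewrite integral_indic ?setIT//.
  rewrite -[X in measurable X]setTI; apply: measurable_trow => // i.
  under eq_fun do rewrite mxE.
  by apply: measurable_funD => //; exact: measurable_rowt_coord.
transitivity (\int[lebesgue_tuple R d]_t (\1_F t)%:E)%E; first exact: H.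
by rewrite integral_indic ?setIT.
Qed.

End Parallelepiped.

(** * Vertices and triangulated cones *)
Section Vertices.
Variables (R : realType) (n m : nat).
Local Notation V := 'rV[R]_n.
Variables (A : 'I_m -> V) (b : 'I_m -> R).
Local Notation P := (Hpoly A b).
Implicit Types (p s x : V).

Lemma vertex_mem (Q : set V) p : vertices Q p -> Q p.
Proof.
move=> [c [c0 [_ /seteqP[sub _]]]]; by have [] := sub p erefl.
Qed.

(** The sum of the active constraints exposes the face that they define. *)
Lemma vertex_criterion p : P p ->
  (forall x, P x -> (forall j, active A b p j -> dotp (A j) (x - p) = 0) -> x = p) ->
  vertices P p.
Proof.
move=> Pp h.
pose c : V := \sum_(j | active A b p j) A j.
have cE x : dotp c x = \sum_(j | active A b p j) dotp (A j) x.
  rewrite /c; elim/big_ind2: _ => //; first by rewrite dotpC dotp0r.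
  by move=> v1 v2 y1 y2 e1 e2; rewrite dotpDl e1 e2.
exists c, (\sum_(j | active A b p j) b j); split.
  by move=> x Px; rewrite cE; apply: ler_sum => j _; exact: Px.
apply/seteqP; split=> x /=.
  by move=> ->; split => //; rewrite cE; apply: eq_bigr => j /eqP.
move=> [Px cx]; apply: h => // j pj; rewrite dotpBr (eqP pj).
have : \sum_(j | active A b p j) (b j - dotp (A j) x) = 0 by rewrite sumrB -cE cx subrr.
move=> /eqP; rewrite psumr_eq0 => [|i _]; last by rewrite subr_ge0; exact: Px.
by move=> /allP /(_ j (mem_index_enum _)) /implyP /(_ pj) /eqP; lra.
Qed.

Lemma closed_Hpoly : closed P.
Proof.
move=> p clp; apply: contrapT => /Hpoly_compl_near[e e0 He].
have [x [Px]] := clp _ (nbhsx_ballx p e e0).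
by rewrite -ball_normE/= distrC => /He.
Qed.

Lemma continuous_normsq : continuous (fun x : V => dotp x x).
Proof.
rewrite /dotp; elim: (index_enum _) => [|i r IH].
  rewrite (_ : (fun x => _) = fun=> 0); last by apply/funext => y; rewrite big_nil.
  by move=> x; exact: (@cst_continuous V R 0 x).
rewrite (_ : (fun x => _) = fun y : V => y 0 i * y 0 i + \sum_(i <- r) y 0 i * y 0 i).
  move=> x.
  have cc : (fun y : V => y 0 i) @ x --> x 0 i by apply: coord_continuous.
  exact: (@cvgD R R V (nbhs x) (nbhs_filter x) _ _ _ _ (cvgM cc cc) (IH x)).
by apply/funext => y; rewrite big_cons.
Qed.

(** A point of [P] farthest from the origin is not the midpoint of a segment of [P],
    by the parallelogram identity. *)
Lemma vertex_exists : (exists x, P x) -> (exists K, forall x, P x -> `|x| <= K) ->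
  exists s, vertices P s.
Proof.
move=> P0 [K hK].
have cP : compact P.
  apply: bounded_closed_compact; last exact: closed_Hpoly.
  exists K; split; [exact: num_real|move=> M KM x /hK xK]; exact: le_trans xK (ltW KM).
have cf : {within P, continuous (fun x : V => dotp x x)}.
  by apply: continuous_subspaceT; exact: continuous_normsq.
have [p pP pmax] := compact_EVT_max P0 cP cf.
have Pp : P p by rewrite inE in pP.
exists p; apply: vertex_criterion => // x Px hx; apply/eqP; rewrite -subr_eq0.
apply: contraT => v0; set v := x - p in v0.
have [e e0 He] := local_active Pp.
have [c c0 cv] := exists_small_scale v e0.
have mem k : `|k| = c -> P (p + k *: v).
  move=> kc; apply/He; first by rewrite addrC addKr normrZ kc -(gtr0_norm c0) -normrZ.
  by move=> j pj; rewrite addrC addKr dotpZr hx// mulr0.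
have sq k : `|k| = c -> dotp (p + k *: v) (p + k *: v) <= dotp p p.
  by move=> kc; apply: pmax; rewrite inE; exact: mem.
have := sq c (gtr0_norm c0); have := sq (- c); rewrite normrN gtr0_norm// => /(_ erefl).
rewrite !(dotpDr, dotpDl) !(dotpZr, dotpZl) !(dotpC v p).
have := dotpxx_gt0 v0 => vv.
have : 0 < c * (c * dotp v v) by rewrite !mulr_gt0.
lra.
Qed.

(** If some [s'] other than [s] saturated the constraints that are active at [s], the
    segment from [s'] to [s] would extend beyond [s] inside [P]. *)
Lemma vertex_active_inj s s' : vertices P s -> P s' ->
  (forall j, active A b s j -> active A b s' j) -> s' = s.
Proof.
move=> vs Ps' act; have Ps := vertex_mem vs.
have [c [c0 [cP /seteqP[sub1 sub2]]]] := vs.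
have [_ cs] := sub1 s erefl.
apply: sub2; split => //=; apply/eqP; rewrite eq_le cP//=.
have [e e0 He] := local_active Ps.
pose v := s' - s.
have [k k0 kv] := exists_small_scale v e0.
have Pm : P (s + (- k) *: v).
  apply/He; first by rewrite addrC addKr scaleNr normrN.
  move=> j sj; rewrite addrC addKr dotpZr dotpBr (eqP sj).
  by rewrite (eqP (act _ sj)) subrr mulr0.
have := cP _ Pm; rewrite dotpDr dotpZr cs dotpBr cs mulNr gerDl oppr_le0 pmulr_rge0//.
by rewrite subr_ge0.
Qed.

Lemma finite_vertices : finite_set (vertices P).
Proof.
(* [None] is reserved for the points that are not vertices, where the active set
   is not injective *)
pose f s : option {set 'I_m} :=
  if `[< vertices P s >] then Some [set j | active A b s j]%SET else None.
rewrite (_ : vertices P = f @^-1` [set o | o != None]).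
  apply: finite_preimage; last exact: finite_finset.
  move=> s s'; rewrite !inE /= /f; case: asboolP => // vs _; case: asboolP => // vs' _ [].
  move=> /setP ss'; apply/esym/(vertex_active_inj vs (vertex_mem vs')) => j sj.
  by have := ss' j; rewrite !inE sj => <-.
by apply/seteqP; split => s /=; rewrite /f; case: asboolP.
Qed.

End Vertices.

Section Cones.
Variables (R : realType) (n d : nat).
Local Notation V := 'rV[R]_n.
Implicit Types (u v : 'M[int]_(d, n)).

Lemma cone_row u i : cone u (row i (toR R u)).
Proof.
exists (delta_mx 0 i); last exact: rowE.
by move=> j; rewrite mxE eqxx/=; case: (_ == _).
Qed.

Lemma cone0 u : @cone R n d u 0.
Proof. by exists 0; rewrite ?mul0mx// => i; rewrite mxE. Qed.

Lemma face_cone0 u c (h : R) : (exists2 x, cone u x & dotp c x = h) ->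
  (forall x, cone u x -> dotp c x <= h) -> h = 0.
Proof.
move=> [_ [t t0 ->] ch] cmax; apply/eqP; rewrite eq_le; apply/andP; split.
  have : dotp c (2 *: (t *m toR R u)) <= h.
    apply: cmax; exists (2 *: t); last by rewrite scalemxAl.
    by move=> i; rewrite mxE mulr_ge0.
  rewrite dotpZr ch; lra.
by have := cmax 0 (cone0 u); rewrite dotp0r.
Qed.

(** A face meeting the interior of a cone is the whole cone; a face of a second
    cone containing a spanning cone is the whole second cone. *)
Lemma triangulation_interior (K : set V) (D : seq 'M[int]_(d, n)) u v (t : 'rV[R]_d) :
  is_triangulation K D -> u \in D -> v \in D -> (toR R v <= toR R u)%MS ->
  (forall i, 0 < t 0 i) -> cone v (t *m toR R u) -> u = v.
Proof.
move=> [_ injD _ _ faceD] uD vD vu t0 vt.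
have [[c [h [cmax cF]]] [c' [h' [cmax' cF']]]] := faceD u v uD vD.
have ut : cone u (t *m toR R u) by exists t => // i; exact/ltW.
have subF x : (cone u `&` cone v) x -> dotp c x = h by rewrite cF => -[].
have subF' x : (cone u `&` cone v) x -> dotp c' x = h' by rewrite cF' => -[].
have h0 : h = 0 by apply: face_cone0 cmax; exists (t *m toR R u) => //; exact: subF.
have h'0 : h' = 0 by apply: face_cone0 cmax'; exists 0; [exact: cone0|apply: subF'; split; exact: cone0].
have cu i : dotp c (row i (toR R u)) = 0.
  have : \sum_i t 0 i * - dotp c (row i (toR R u)) = 0.
    under eq_bigr do rewrite mulrN.
    by rewrite sumrN -dotp_mulmx subF// h0 oppr0.
  move=> /eqP; rewrite psumr_eq0 => [|j _]; last first.
    by rewrite mulr_ge0 ?(ltW (t0 _))// oppr_ge0 -h0; apply: cmax; exact: cone_row.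
  move=> /allP /(_ i (mem_index_enum _)) /=.
  by rewrite mulf_eq0 gt_eqF//= oppr_eq0 => /eqP.
have uv (x : V) : cone u x -> cone v x.
  move=> ux; suff : [set x | cone u x /\ dotp c x = h] x by rewrite -cF => -[].
  split => //; move: ux => [z _ ->].
  by rewrite h0 dotp_mulmx big1// => i _; rewrite cu mulr0.
have c'u i : dotp c' (row i (toR R u)) = 0.
  by rewrite -h'0; apply: subF'; split; [|apply: uv]; exact: cone_row.
have vu' (x : V) : cone v x -> cone u x.
  move=> vx; suff : [set x | cone v x /\ dotp c' x = h'] x by rewrite -cF' => -[].
  split => //; move: vx => [z _ ->].
  have /submxP[W ->] := vu; rewrite mulmxA h'0 dotp_mulmx big1// => i _.
  by rewrite c'u mulr0.
by apply: injD => //; apply/seteqP; split.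
Qed.

End Cones.

(** * The meromorphic cone terms *)
Section ConeTerm.
Variables (R : realType) (n d M : nat).
Implicit Types (l s a : 'rV[R]_n) (u : 'M[int]_(d, n)).

Definition cone_quot s u a l (e : R) : R :=
  dotp (l + e *: a) s ^+ (M + d) / \prod_i dotp (- l - e *: a) (gen R u i).

(** The exponential series contributes [<l, s>^(M+d) / (M+d)!] and the generators
    the pole of order [d]. *)
Lemma exp_cone_coef s u l : regular u l ->
  laurent_coef (fun t => exp_cone s u (t *: l)) M%:Z =
  vol d (@parallelepiped R n d u) * (dotp l s ^+ (M + d) / (M + d)`!%:R) /
    \prod_i dotp (- l) (gen R u i).
Proof.
move=> /forallP ru.
pose C := vol d (@parallelepiped R n d u) / \prod_i dotp (- l) (gen R u i).
pose z (k : int) : R := if 0 <= k + d%:Z then C * (dotp l s ^+ absz (k + d%:Z) / (absz (k + d%:Z))`!%:R) else 0.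
have zN (k : int) : k < - d%:Z -> z k = 0.
  by move=> kN; rewrite /z ifF//; apply/negbTE; rewrite -ltNge; lia.
have hz : is_laurent (fun t => exp_cone s u (t *: l)) z.
  exists d; apply/(laurent_fromP _ zN).
  have t0 : \forall t \near (0 : R)^', t != 0 by exact: nbhs_dnbhs_neq.
  apply: filterS t0 => t t0.
  have -> : t ^+ d * exp_cone s u (t *: l) = C * expR (t * dotp l s).
    rewrite /exp_cone dotpZl /C.
    have -> : \prod_i (dotp (- (t *: l)) (gen R u i))^-1 =
        t ^- d * (\prod_i dotp (- l) (gen R u i))^-1.
      rewrite -prodfV -[d in t ^- d]card_ord -prodr_const -prodfV -big_split.
      by apply: eq_bigr => i _; rewrite -scalerN dotpZl invfM.
    move: (\prod_i dotp (- l) (gen R u i))^-1 => q.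
    by field; rewrite expf_neq0.
  apply: eq_cvgn (cvgM (cvg_cst C) (is_cvg_series_exp_coeff (t * dotp l s))) => N.
  rewrite -[LHS]/(C * series _ N) /series/= mulr_sumr; apply: eq_bigr => j _.
  by rewrite /pterm /z subrK /= /exp_coeff/= exprMn; ring.
rewrite (laurent_coefE hz) /z -PoszD /= /C; ring.
Qed.

(** In the regular case there is no pole and the constant term is the value at
    [e = 0]; otherwise dividing by [e] turns the constant term into a residue. *)
Lemma cone_quot_laurent s u a l :
  (forall i, exists e, dotp (- l - e *: a) (gen R u i) != 0) ->
  exists2 z, is_laurent (cone_quot s u a l) z &
    LM_cone M s u a l =
      M`!%:R / (M + d)`!%:R * vol d (@parallelepiped R n d u) * z 0.
Proof.
move=> h.
pose p : {poly R} := ((dotp l s)%:P + dotp a s *: 'X) ^+ (M + d).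
have pE e : p.[e] = dotp (l + e *: a) s ^+ (M + d).
  rewrite horner_exp hornerD hornerZ hornerC hornerX dotpDl dotpZl; congr (_ ^+ _); ring.
have qE e i : - dotp l (gen R u i) + - dotp a (gen R u i) * e = dotp (- l - e *: a) (gen R u i).
  by rewrite dotpDl !dotpNl dotpZl; ring.
have [|z hz z0] := @laurent_rational R p 'I_d (fun i => - dotp l (gen R u i))
    (fun i => - dotp a (gen R u i)).
  by move=> i; have [e he] := h i; exists e; rewrite qE.
exists z.
  apply: is_laurent_ext hz; apply: filterE => e; rewrite pE; congr (_ / _).
  by apply: eq_bigr => i _.
rewrite /LM_cone; case: ifPn => ru.
  rewrite exp_cone_coef// z0; last by move=> i; rewrite oppr_eq0; move/forallP: ru.
  rewrite pE scale0r addr0.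
  rewrite [in RHS](eq_bigr (fun i => dotp (- l) (gen R u i))); last by move=> i _; rewrite dotpNl.
  ring.
congr (_ * _); rewrite /residue.
rewrite (_ : z 0 = z (-1 + 1)); last by congr z.
have := laurent_coefE (is_laurent_divX hz) => /(congr1 (fun f => f (-1))) <-.
congr (laurent_coef _ _); apply/funext => e; rewrite pE.
rewrite invfM mulrCA mulrC; congr (_ / _ * _).
by apply: eq_bigr => i _.
Qed.

End ConeTerm.

(** * Transfer to the affine hull *)
Section Transfer.
Variables (R : realType) (n d m : nat).
Local Notation V := 'rV[R]_n.
Local Notation E := 'rV[R]_d.
Variables (A : 'I_m -> V) (b : 'I_m -> R) (x0 : V) (B : 'M[R]_(d, n)).
Local Notation P := (Hpoly A b).
Implicit Types (s x : V) (y p : E).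

(** The rows of [B] parametrize the direction of [P]: points [y] of [R^d] are lifted to
    the affine hull, and points, forms and constraints of the ambient space are
    lowered to [R^d]. *)
Definition lift_pt y : V := x0 + y *m B.
Definition low_pt x : E := (x - x0) *m pinvmx B.
Definition low_form (l : V) : E := l *m B^T.
Definition low_A j : E := low_form (A j).
Definition low_b j : R := b j - dotp (A j) x0.

Lemma dotp_low_form (l : V) y : dotp (low_form l) y = dotp l (y *m B).
Proof.
rewrite dotpC /low_form /dotp; under eq_bigr do rewrite mxE mulr_sumr.
rewrite exchange_big; apply: eq_bigr => j _; rewrite mxE mulr_sumr.
by apply: eq_bigr => i _; rewrite mxE; ring.
Qed.

Lemma dotp_lift (l : V) y : dotp l (lift_pt y) = dotp (low_form l) y + dotp l x0.
Proof. by rewrite dotpDr dotp_low_form addrC. Qed.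

Lemma low_HpolyE y : Hpoly low_A low_b y <-> P (lift_pt y).
Proof.
split=> h j; have := h j; rewrite dotp_lift /low_A /low_b; lra.
Qed.

Lemma low_activeE p j : active low_A low_b p j = active A b (lift_pt p) j.
Proof. by rewrite /active dotp_lift /low_A /low_b; apply/eqP/eqP; lra. Qed.

Lemma low_ptK : row_free B -> cancel lift_pt low_pt.
Proof.
move=> fB y; rewrite /low_pt /lift_pt addrC addKr; apply: (row_free_inj fB).
by rewrite mulmxKpV// submxMl.
Qed.

Lemma lift_ptK x : (x - x0 <= B)%MS -> lift_pt (low_pt x) = x.
Proof. by move=> xB; rewrite /lift_pt mulmxKpV// addrC subrK. Qed.

Lemma low_feasible p y :
  feasible_cone (Hpoly low_A low_b) p y <-> feasible_cone P (lift_pt p) (y *m B).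
Proof.
have H e : Hpoly low_A low_b (p + e *: y) <-> P (lift_pt p + e *: (y *m B)).
  by rewrite low_HpolyE /lift_pt mulmxDl scalemxAl addrA.
by split=> -[e e0 /H he]; exists e.
Qed.

Lemma low_nonvertex p : row_free B -> (forall x, P x -> (x - x0 <= B)%MS) ->
  P (lift_pt p) -> ~ vertices P (lift_pt p) -> nonvertex_line low_A low_b p.
Proof.
move=> fB PB Pp nv; apply: contrapT => nl; apply: nv; apply: vertex_criterion => // x Px hx.
apply/eqP; apply: contraT => xp; case: nl.
have xE := lift_ptK (PB _ Px).
exists (low_pt x - p).
  by apply: contra xp; rewrite subr_eq0 => /eqP <-; rewrite xE.
move=> j; rewrite low_activeE => /hx; rewrite -{1}xE !dotpBr !dotp_lift /low_A.
by move=> h; lra.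
Qed.

Lemma low_bounded : row_free B -> (exists K, forall x, P x -> `|x| <= K) ->
  exists K, forall y, Hpoly low_A low_b y -> `|y| <= K.
Proof.
move=> fB [K hK]; exists (\sum_i (K + `|x0|) * `|row i (pinvmx B)|) => y /low_HpolyE /hK Ky.
rewrite -(low_ptK fB y) /low_pt mulmx_sum_row (le_trans (ler_norm_sum _ _ _))//.
apply: ler_sum => i _; rewrite normrZ ler_wpM2r//.
apply: (le_trans (normr_coord _ _)).
by rewrite (le_trans (ler_normB _ _))// lerD2r.
Qed.

End Transfer.

Section TransferCones.
Variables (R : realType) (n d : nat).
Local Notation V := 'rV[R]_n.
Variables (B : 'M[int]_(d, n)).
Hypothesis fB : row_free (toR R B).
Implicit Types (u v : 'M[int]_(d, n)).

(** The coordinates of the generators [u] in the lattice basis [B]. *)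
Definition low_frame u : 'M[R]_d := toR R u *m pinvmx (toR R B).

Lemma low_frameK u : (toR R u <= toR R B)%MS -> low_frame u *m toR R B = toR R u.
Proof. exact: mulmxKpV. Qed.

Lemma low_frame_unit u : (toR R u <= toR R B)%MS -> row_free (toR R u) ->
  low_frame u \in unitmx.
Proof.
move=> uB fu; rewrite -row_free_unit /row_free eqn_leq rank_leq_row.
by rewrite -{1}(eqP fu) -(low_frameK uB) mxrankM_maxl.
Qed.

Lemma low_frame_row u i : (toR R u <= toR R B)%MS ->
  row i (low_frame u) *m toR R B = gen R u i.
Proof. by move=> uB; rewrite -row_mul low_frameK. Qed.

Lemma low_frame_inj u v : (toR R u <= toR R B)%MS -> (toR R v <= toR R B)%MS ->
  low_frame u = low_frame v -> u = v.
Proof.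
move=> uB vB uv; apply: (@toR_inj R).
by rewrite -(low_frameK uB) uv low_frameK.
Qed.

Lemma low_cone u (y : 'rV[R]_d) : (toR R u <= toR R B)%MS -> row_free (toR R u) ->
  cone u (y *m toR R B) <-> frame_cone (low_frame u) y.
Proof.
move=> uB fu; have uu := low_frame_unit uB fu; split=> [[t t0]|h].
  rewrite -(low_frameK uB) mulmxA => /(row_free_inj fB) -> i.
  by rewrite mulmxK.
exists (y *m invmx (low_frame u)) => //.
by rewrite -(low_frameK uB) mulmxA mulmxKV.
Qed.

Lemma low_triangulation (K : set V) (K' : set 'rV[R]_d) (D : seq 'M[int]_(d, n)) :
  is_triangulation K D -> {in D, forall u, (toR R u == toR R B)%MS} ->
  (forall y, K' y <-> K (y *m toR R B)) ->
  frame_cover K' [seq low_frame u | u <- D].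
Proof.
move=> tri DB KK'; have [uD injD freeD covD faceD] := tri.
have DB1 u : u \in D -> (toR R u <= toR R B)%MS by move=> /DB/andP[].
split.
- by rewrite map_inj_in_uniq// => u v uD' vD'; apply: low_frame_inj; exact: DB1.
- by move=> _ /mapP[u us ->]; apply: low_frame_unit; [exact: DB1|exact: freeD].
- move=> y; rewrite KK' covD; split=> [[u /= us uy]|[_ /mapP[u us ->] uy]].
    by exists (low_frame u); [exact: map_f|apply/low_cone => //; [exact: DB1|exact: freeD]].
  by exists u => //; apply/low_cone => //; [exact: DB1|exact: freeD].
- move=> _ _ /mapP[u us ->] /mapP[v vs ->] y uy vy; congr low_frame.
  have uu := low_frame_unit (DB1 _ us) (freeD _ us).
  apply: (triangulation_interior tri us vs _ uy).
    apply: submx_trans (DB1 _ vs) _; by have /andP[] := DB _ us.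
  have -> : y *m invmx (low_frame u) *m toR R u = y *m toR R B.
    by rewrite -(low_frameK (DB1 _ us)) mulmxA mulmxKV.
  by apply/low_cone => //; [exact: DB1|exact: freeD].
Qed.

End TransferCones.

Theorem corollary6 (R : realType) (n d M : nat) (P : set 'rV[R]_n)
    (D : 'rV[R]_n -> seq 'M[int]_(d, n)) (l a : 'rV[R]_n) :
  rational_polytope P -> has_dim P d ->
  (forall s, vertices P s -> is_triangulation (feasible_cone P s) (D s)) ->
  (forall s u (i : 'I_d), vertices P s -> u \in D s ->
     exists e : R, dotp (- l - e *: a) (gen R u i) != 0) ->
  LM d M P l = \sum_(s \in vertices P) \sum_(u <- D s) LM_cone M s u a l.
Proof.
move=> [[m [A0 [b0 PE]]] bP] dimP triD hden.
pose A j : 'rV[R]_n := map_mx ratr (row j A0); pose b j : R := ratr (b0 j 0).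
have PH : P = Hpoly A b by [].
clear PE; subst P; set P := Hpoly A b in bP dimP triD hden *.
have {bP} bP : exists K, forall x, P x -> `|x| <= K.
  by have [K [_ hK]] := bP; exists (K + 1); apply: hK; rewrite ltrDl.
have Pne := has_dim_nonempty dimP.
pose x0 := xget 0 P.
have Px0 : P x0 by have [x Px] := Pne; apply: (xgetPex _ (ex_intro _ _ Px)).
have [W fW dirW] := dimP.
(* [d] free vectors in the direction of [P] span it *)
have uW s u : vertices P s -> u \in D s -> (toR R u == W)%MS.
  move=> vs us; have [_ _ freeD covD _] := triD _ vs.
  have uW : (toR R u <= W)%MS.
    apply/row_subP => i.
    have [e e0 Pe] : feasible_cone P s (row i (toR R u)).
      by rewrite covD; exists u => //; exact: cone_row.
    have : direction P (e *: row i (toR R u)).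
      have -> : e *: row i (toR R u) = (s + e *: row i (toR R u)) - s by rewrite addrC addKr.
      by apply: direction_sub => //; exact: vertex_mem vs.
    by rewrite dirW /= eqmx_scale// gt_eqF.
  have /mxrank_leqif_eq[_] := uW.
  by rewrite (eqP fW) (eqP (freeD _ us)) eqxx => <-.
have dirE s u : vertices P s -> u \in D s -> direction P = [set v : 'rV[R]_n | (v <= toR R u)%MS].
  move=> vs us; rewrite dirW; have /eqmxP uWE := uW _ _ vs us.
  by apply/seteqP; split=> v /=; rewrite uWE.
have [s0 vs0] := vertex_exists Pne bP.
have [u0 u0D] : exists u, u \in D s0.
  have [_ _ _ covD _] := triD _ vs0.
  have : feasible_cone P s0 0.
    by exists 1 => //; rewrite scaler0 addr0; exact: vertex_mem vs0.
  by rewrite covD => -[u /= us _]; exists u.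
(* the direction is spanned by integral vectors, namely the generators of a cone at
   some vertex *)
pose B := @lattice_basis R n d (direction P).
have [fB BL] : is_lattice_basis (direction P) B.
  apply: xgetPex; rewrite (dirE _ _ vs0 u0D); apply: lattice_basis_exists.
  by have [_ _ freeD _ _] := triD _ vs0; exact: freeD.
have WB : (W == toR R B)%MS.
  have u0B : (toR R u0 <= toR R B)%MS.
    apply/row_subP => i; have -> : row i (toR R u0) = toR R (row i u0) by rewrite /toR map_row.
    have /BL[w ->] : direction P (toR R (row i u0)).
      by rewrite (dirE _ _ vs0 u0D) /= /toR map_row row_sub.
    by rewrite toRM submxMl.
  have /eqmxP uWE := uW _ _ vs0 u0D.
  have WB : (W <= toR R B)%MS by rewrite -uWE.
  by have /mxrank_leqif_eq[_] := WB; rewrite (eqP fW) (eqP fB) eqxx => <-.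
have uB s u : vertices P s -> u \in D s -> (toR R u == toR R B)%MS.
  by move=> vs us; have /eqmxP h1 := uW _ _ vs us; have /eqmxP h2 := WB;
    apply/eqmxP; exact: eqmx_trans h1 h2.
have PB x : P x -> (x - x0 <= toR R B)%MS.
  move=> Px; have : direction P (x - x0) by exact: direction_sub.
  by rewrite dirW => /submx_trans; apply; have /andP[] := WB.
have finV : finite_set (vertices P) by exact: finite_vertices.
pose Vs : seq 'rV[R]_n := finmap.enum_fset (fset_set (vertices P)).
have VsP s : (s \in Vs) = (s \in vertices P) by rewrite /Vs in_fset_set.
pose low := low_pt x0 (toR R B); pose lft := lift_pt x0 (toR R B).
have lowK s : vertices P s -> lft (low s) = s.
  by move=> /vertex_mem Ps; apply: lift_ptK; exact: PB.
pose S := [seq low s | s <- Vs].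
pose D' (y : 'rV[R]_d) : seq 'M[R]_d := [seq low_frame R B u | u <- D (lft y)].
pose A' := low_A A (toR R B); pose b' := low_b A b x0.
pose l' := low_form (toR R B) l; pose a' := low_form (toR R B) a.
have SP y : y \in S -> vertices P (lft y).
  by move=> /mapP[s]; rewrite VsP inE => vs ->; rewrite lowK.
pose c u : R := M`!%:R / (M + d)`!%:R * vol d (@parallelepiped R n d u).
have termE s u e : vertices P (lft s) -> u \in D (lft s) ->
    brion_term M (l' + e *: a') (dotp l x0 + e * dotp a x0) s (low_frame R B u) =
    c u * cone_quot M (lft s) u a l e.
  move=> vs us; have /andP[uBl _] := uB _ _ vs us.
  rewrite /brion_term /c /cone_quot mulrA.
  rewrite (@vol_parallelepiped _ _ _ u B (low_frame R B u)) ?low_frameK//; last 2 first.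
  - by rewrite -(dirE _ _ vs us).
  - by apply: low_frame_unit => //; have [_ _ freeD _ _] := triD _ vs; exact: freeD.
  congr (_ * _ ^+ _ / _).
    by rewrite !dotpDl !dotpZl /l' /a' !dotp_lift; ring.
  apply: eq_bigr => i _; rewrite /l' /a' !dotpDl !dotpZl !dotp_low_form low_frame_row//.
  by rewrite !dotpNl dotpZl; ring.
(* an expansion of each lowered term, with the required constant term *)
have zex y U : exists z, y \in S -> U \in D' y ->
    is_laurent (fun e => brion_term M (l' + e *: a') (dotp l x0 + e * dotp a x0) y U) z /\
    forall u, u \in D (lft y) -> U = low_frame R B u -> z 0 = LM_cone M (lft y) u a l.
  have [[yS /mapP[u us UE]]|ns] := pselect (y \in S /\ U \in D' y); last first.
    by exists (fun=> 0) => yS UD; case: ns.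
  have vs := SP _ yS.
  have [|z hz zE] := @cone_quot_laurent R n d M (lft y) u a l.
    by move=> i; exact: (hden _ _ i vs us).
  exists (fun k => c u * z k) => _ _; split.
    apply: is_laurent_ext (is_laurentZ _ hz); apply: filterE => e.
    by rewrite UE termE.
  have /andP[uBl _] := uB _ _ vs us.
  move=> v vD; have /andP[vBl _] := uB _ _ vs vD.
  by rewrite UE => /(low_frame_inj uBl vBl) <-; rewrite zE.
pose Z y U := sval (cid (zex y U)).
have hZ y U := svalP (cid (zex y U)).
transitivity (\int[lebesgue_tuple R d]_(t in @rowt R d @^-1` Hpoly A' b')
    (dotp l' (rowt t) + dotp l x0) ^+ M).
  rewrite /LM (_ : @chart R n d P @^-1` P = @rowt R d @^-1` Hpoly A' b').
    by apply: eq_Rintegral => t _; rewrite -dotp_lift.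
  apply/seteqP; split=> t /=; first by move=> Pt; apply/low_HpolyE.
  by move/low_HpolyE.
rewrite (@brion_laurent R d m A' b' M l' a' (dotp l x0) (dotp a x0) S D' Z).
- rewrite fsbig_finite// -/Vs /S big_map big_seq [RHS]big_seq.
  apply: eq_bigr => s sVs; have vs : vertices P s by move: sVs; rewrite VsP inE.
  rewrite /D' big_map lowK// big_seq [RHS]big_seq; apply: eq_bigr => u us.
  have lS : low s \in S by apply: map_f.
  have us' : u \in D (lft (low s)) by rewrite lowK.
  have [_ h] := hZ (low s) (low_frame R B u) lS (map_f _ us').
  transitivity (LM_cone M (lft (low s)) u a l); last by rewrite lowK.
  exact: h.
- rewrite map_inj_in_uniq; first exact: finmap.fset_uniq.
  move=> s s'; rewrite !VsP !inE => vs vs' ss'.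
  by rewrite -(lowK _ vs) ss' lowK.
- by move=> y /SP/vertex_mem Py; apply/low_HpolyE.
- move=> y /SP vy; apply: low_triangulation => //.
  + exact: triD vy.
  + by move=> u us; exact: uB vy us.
  + by move=> z; exact: low_feasible.
- move=> p /low_HpolyE Pp pS; apply: low_nonvertex => //.
  move=> vp; move/negP: pS; apply; apply/mapP; exists (lft p).
    by rewrite VsP inE.
  by rewrite /low /lft low_ptK.
- by apply: low_bounded.
- move=> y /SP vy _ /mapP[u us ->] i.
  have [e he] := hden _ _ i vy us; exists e; have /andP[uBl _] := uB _ _ vy us.
  rewrite /l' /a' !dotp_low_form low_frame_row//.
  by move: he; rewrite dotpDl !dotpNl dotpZl -opprD oppr_eq0.
- by move=> y yS U UD; have [] := hZ y U yS UD.
Qed.
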